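(* Let $k=\mathbb{F}_q[X]/f(X)$ be a field extension of $\mathbb{F}_q$ of degree $r$, where $r$ is a prime power not divisible by the characteristic of $\mathbb{F}_q$, and let $s$ be the order of $q$ in $(\mathbb{Z}/r\mathbb{Z})^\times$. Using Allombert's revised algorithm, a solution $\theta\in k[\zeta]$ to Hilbert's theorem 90, i.e. a non-zero $\theta\in k[\zeta]$ with $\sigma(\theta)=\zeta\theta$, can be computed in $$O(\mathsf{M}(r) \log(q) + s r \mathsf{M}(r) + r^\omega)$$ operations in $\mathbb{F}_q$.
   Context: Let $h(Z)\in\mathbb{F}_q[Z]$ be an irreducible factor of the $r$-th cyclotomic polynomial over $\mathbb{F}_q$; it has degree $s$. Put $\mathbb{F}_q(\zeta)=\mathbb{F}_q[Z]/h(Z)$ (a field) and $k[\zeta]=k[Z]/h(Z)\cong k\otimes_{\mathbb{F}_q}\mathbb{F}_q(\zeta)$ (a ring), where $\zeta$ is the class of $Z$. Let $\sigma$ be the $\mathbb{F}_q(\zeta)$-algebra automorphism of $k[\zeta]$ given by $a\otimes c\mapsto a^q\otimes c$ for $a\in k$, $c\in\mathbb{F}_q(\zeta)$. For a polynomial $A$ with coefficients in $\mathbb{F}_q(\zeta)$ write $\hat A=A(\sigma)$ for the corresponding linear endomorphism of $k[\zeta]$. Allombert's revised algorithm: factor $h(S)=(S-\zeta)b(S)$, where, if $h(S)=S^s+\sum_{i=0}^{s-1}h_iS^i$, one has $b(S)=\sum_{i=0}^{s-1}b_i(S)\zeta^i$ with $b_{s-1}(S)=1$ and $b_{i-1}(S)=b_i(S)S+h_i$.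 Compute the matrix of $\sigma$ over $k$, then the matrix of $\hat h$ acting on $k$ (over $\mathbb{F}_q$), find by linear algebra over $\mathbb{F}_q$ an element of $k$ in the kernel of $\hat h$, and return the value of $\hat b$ on it. Cost model: costs are counted in number of operations $+,\times,\div$ in $\mathbb{F}_q$; algorithms may be randomized (Las Vegas) and $O(\,)$ then denotes average (expected) cost. $\mathsf{M}(m)$ is a function such that polynomials in $\mathbb{F}_q[X]$ of degree less than $m$ can be multiplied in $\mathsf{M}(m)$ operations in $\mathbb{F}_q$, with the usual super-linearity assumptions ($\mathsf{M}(n)/n\ge \mathsf{M}(m)/m$ for $n\ge m$, $\mathsf{M}(mn)\le m^2\mathsf{M}(n)$), and $\mathsf{M}(mn)\in O(m^{1+\varepsilon}\mathsf{M}(n))$ for all $\varepsilon>0$. The constant $\omega>2$ is such that $m\times m$ matrices over any field can be multiplied using $O(m^\omega)$ field additions and multiplications. *)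

(* Defs.v *)
From mathcomp Require Import all_boot all_order all_fingroup all_algebra.
From mathcomp Require Import all_field qpoly.
From mathcomp Require Import reals exp.

Set Implicit Arguments.
Unset Strict Implicit.
Unset Printing Implicit Defensive.

Import Order.TTheory GRing.Theory Num.Theory.
Local Open Scope ring_scope.

(* Cost model: straight-line programs over a field, that is, arithmetic
   circuits given in topological order.  Each instruction appends one field
   element to an append-only memory, which initially holds the input, and refers
   to earlier elements by their position.  [IsZero] returns 1 or 0; together
   with arithmetic it replaces branching by selection.  There is deliberately no
   control flow depending on the data: when only field operations are counted,
   a branching program over a small field could read its whole input and look
   the answer up.  A program cannot depend on its input, but it may contain
   constants of the field. *)
Inductive instr (F : Type) : Type :=
| Const of F
| Add of nat & nat
| Sub of nat & nat
| Mul of nat & nat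
| Div of nat & nat
| IsZero of nat.

Arguments Add {F}.
Arguments Sub {F}.
Arguments Mul {F}.
Arguments Div {F}.
Arguments IsZero {F}.

Definition exec (F : fieldType) (mem : seq F) (c : instr F) : option F :=
  match c with
  | Const a => Some a
  | Add i j => Some (mem`_i + mem`_j)
  | Sub i j => Some (mem`_i - mem`_j)
  | Mul i j => Some (mem`_i * mem`_j)
  | Div i j => if mem`_j == 0 then None else Some (mem`_i / mem`_j)
  | IsZero i => Some (mem`_i == 0)%:R
  end.

Fixpoint run (F : fieldType) (code : seq (instr F)) (mem : seq F) :
    option (seq F) :=
  if code is c :: code' then
    if exec mem c is Some a then run code' (rcons mem a) else None
  else Some mem.

(* Everything but writing down a constant costs one operation, zero tests
   included. *)
Definition is_op (F : Type) (c : instr F) : bool :=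
  if c is Const _ then false else true.

Definition cost (F : Type) (code : seq (instr F)) : nat := count (@is_op F) code.

Definition div_test_free (F : Type) (code : seq (instr F)) : bool :=
  all (fun c => match c with Div _ _ | IsZero _ => false | _ => true end) code.

(* [out] lists the positions of the results in the final memory. *)
Definition computes (F : fieldType) (code : seq (instr F)) (out : seq nat)
    (input output : seq F) : Prop :=
  exists2 mem, run code input = Some mem & [seq mem`_i | i <- out] = output.

Definition coefs (F : fieldType) (m : nat) (a : {poly F}) : seq F :=
  mkseq (fun i => a`_i) m.

Definition entries (F : fieldType) (m : nat) (A : 'M[F]_m) : seq F :=
  [seq A i j | i <- enum 'I_m, j <- enum 'I_m].

Definition polymul_cost (R : realType) (F : fieldType) (M : nat -> R) : Prop :=
  forall m, (0 < m)%N ->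
  exists code out, (cost code)%:R <= M m /\
    forall a b : {poly F}, (size a <= m)%N -> (size b <= m)%N ->
      computes code out (coefs m a ++ coefs m b) (coefs (m + m).-1 (a * b)).

Definition superlinear (R : realType) (M : nat -> R) : Prop :=
  (forall m n, (0 < m)%N -> (m <= n)%N -> M m / m%:R <= M n / n%:R) /\
  (forall m n, (0 < m)%N -> (0 < n)%N -> M (m * n)%N <= m%:R ^+ 2 * M n).

Definition almost_linear (R : realType) (M : nat -> R) : Prop :=
  forall eps : R, 0 < eps -> exists c : R, forall m n, (0 < m)%N -> (0 < n)%N ->
    M (m * n)%N <= c * (m%:R `^ (1 + eps)) * M n.

Definition matmul_exponent (R : realType) (omega : R) : Prop :=
  exists c : R, forall (K : fieldType) (m : nat), (0 < m)%N ->
  exists (code : seq (instr K)) (out : seq nat),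
    [/\ div_test_free code, (cost code)%:R <= c * (m%:R `^ omega) &
      forall A B : 'M[K]_m,
        computes code out (entries A ++ entries B) (entries (A *m B))].

Section HilbertNinety.

Variables (F : finFieldType) (f h : {poly F}).

Local Notation q := #|F|.

(* The library's quotient only makes sense for monic polynomials, and [f] need
   not be monic. *)
Definition kfield := {poly %/ (lead_coef f)^-1 *: f}.

Definition Fzeta := {poly %/ h}.

Definition scalar_k : F -> kfield := qpolyC ((lead_coef f)^-1 *: f).

Definition kzeta := {poly %/ map_poly scalar_k h}.

Definition zeta : kzeta := 'qX.

Definition k_to_kzeta : kfield -> kzeta := qpolyC (map_poly scalar_k h).

Definition Fzeta_to_kzeta (c : Fzeta) : kzeta :=
  in_qpoly (map_poly scalar_k h) (map_poly scalar_k c).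

Definition frob (a : kfield) : kfield := a ^+ q.

(* An element of [kzeta] is \sum_i a_i zeta^i with a_i in k, and zeta^i is in
   Fzeta, so that a (x) c |-> a^q (x) c raises each a_i to the power q. *)
Definition sigma (u : kzeta) : kzeta :=
  in_qpoly (map_poly scalar_k h) (map_poly frob u).

Definition hat (A : {poly Fzeta}) (u : kzeta) : kzeta :=
  \sum_(j < size A) Fzeta_to_kzeta A`_j * iter j sigma u.

(* A(sigma) preserves k when A has its coefficients in F, and sigma restricts to
   [frob] on k. *)
Definition hat_k (A : {poly F}) (a : kfield) : kfield :=
  \sum_(j < size A) A`_j *: iter j frob a.

(* [b_desc n] is b_(s-1-n), where s is the degree of [h]; these are the quotients
   in h(S) = (S - zeta) bpoly(S). *)
Fixpoint b_desc (n : nat) : {poly F} :=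
  if n is n'.+1 then b_desc n' * 'X + (h`_((size h).-2 - n'))%:P else 1.

Definition b_ (i : nat) : {poly F} := b_desc ((size h).-2 - i).

Definition bpoly : {poly Fzeta} :=
  \sum_(i < (size h).-1) map_poly (qpolyC h) (b_ i) * (('qX : Fzeta) ^+ i)%:P.

(* Matrix in the basis 1, X, X^2, ... of k over F; columns are images. *)
Definition matrix_k (g : kfield -> kfield) : 'M[F]_((size f).-1) :=
  \matrix_(i, j) (g (in_qpoly ((lead_coef f)^-1 *: f) 'X^j) : {poly F})`_i.

(* One program per step; each step runs on the memory left by the previous ones
   and [at_...] gives the positions of its results. *)
Record algorithm := Algorithm {
  code_sigma : seq (instr F);  at_sigma : nat -> nat -> nat;
  code_hhat  : seq (instr F);  at_hhat  : nat -> nat -> nat;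
  code_ker   : seq (instr F);  at_ker   : nat -> nat;
  code_theta : seq (instr F);  at_theta : nat -> nat -> nat }.

Definition algorithm_cost (A : algorithm) : nat :=
  (cost (code_sigma A) + cost (code_hhat A) + cost (code_ker A)
   + cost (code_theta A))%N.

(* The input consists of all coefficients of [f], then all those of [h];
   [theta] is returned by its coordinates on the zeta^i X^j. *)
Definition allombert_revised (A : algorithm) (theta : kzeta) : Prop :=
  exists (m1 m2 m3 m4 : seq F) (x : kfield),
  [/\ run (code_sigma A) (polyseq f ++ polyseq h) = Some m1
    /\ \matrix_(i, j) m1`_(at_sigma A i j) = matrix_k frob,
      run (code_hhat A) m1 = Some m2
    /\ \matrix_(i, j) m2`_(at_hhat A i j) = matrix_k (hat_k h),
      run (code_ker A) m2 = Some m3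
    /\ [/\ x != 0, hat_k h x = 0 &
         forall j, (j < (size f).-1)%N -> m3`_(at_ker A j) = (x : {poly F})`_j],
      run (code_theta A) m3 = Some m4
    /\ (forall i j, (i < (size h).-1)%N -> (j < (size f).-1)%N ->
         m4`_(at_theta A i j) = ((theta : {poly kfield})`_i : {poly F})`_j) &
      theta = hat bpoly (k_to_kzeta x)].

End HilbertNinety.

Arguments zeta {F f h}.
Arguments sigma {F f h}.

(* Main.v *)
(** The coordinates of theta on 1, zeta, ..., zeta^(s-1) are b_i(Frob)(x), where
    x <> 0 lies in the kernel of h(Frob) on k; the recurrence for the b_i says that
    they are the quotients of h(S) by S - zeta, which makes theta a solution.
    The kernel is nontrivial because h divides S^r - 1 while 1, Frob, ...,
    Frob^(r-1) are linearly independent: g(Frob) is a nonzero q-polynomial of degree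
    at most q^(r-1), so it cannot vanish on the q^r elements of k.

    Products modulo f cost O(M(r)) by Barrett reduction, with the inverse of f
    precomputed naively in O(r^2).  The columns h(Frob)(X^j) are combinations of
    (X^(q^i))^j, i <= s.  Since programs cannot branch, the kernel is found without
    pivoting: a matrix G with A G A = A is computed by a block recursion with four
    half-size calls, hence in O(n^omega) as 4 < 2^omega, and the columns of 1 - G A
    span the kernel of A. *)

(* A program may not depend on its input, so no single pair (f, h) can be treated in isolation: the
   values handled are functions on a set of inputs, the memories form a family of equal length, and
   one address serves the whole set. The set is instantiated only at the end, by all admissible
   pairs. Equal lengths require all admissible h to have the same degree; it is the order s of q,
   because the class of X modulo h is a primitive r-th root of unity. The term in log q stands next
   to a single M(r), so only X^q is obtained by repeated squaring; every later q-th power uses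
   F-linearity of the Frobenius and costs O(r^2) through the matrix of sigma. Terms such as r^2 are
   absorbed by s r M(r) once r <= M(r) is known, and this follows from superlinearity and M(1) >= 1:
   without operations two field elements cannot be multiplied. Matrices are padded with zeros to a
   power of two; copying costs nothing, and generalized inverses, unlike inverses, survive the
   padding. *)
Require Import Defs.
From mathcomp Require Import all_boot all_order all_fingroup all_algebra.
From mathcomp Require Import all_field qpoly cyclic.
From mathcomp Require Import boolp reals exp zify ring lra.

Set Implicit Arguments.
Unset Strict Implicit.
Unset Printing Implicit Defensive.

Import Order.TTheory GRing.Theory Num.Theory.
Local Open Scope ring_scope.

(** * Straight-line programs run on a family of inputs *)

Section Programs.

Variables (F : fieldType) (I : Type).

(** Equal lengths over all inputs make the position of the next result, and hence every address in
    the code, independent of the input. *)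
Record memory := Memory {
  mem_of :> I -> seq F;
  mem_size : nat;
  mem_sizeP : forall x, size (mem_of x) = mem_size }.

Implicit Types (m : memory) (v w : I -> F).

Definition avail m v := exists2 p, (p < mem_size m)%N & forall x, (m x)`_p = v x.

Definition sub_memory m m' := forall v, avail m v -> avail m' v.

Definition reach (c : nat) m m' :=
  exists2 code, (cost code <= c)%N & forall x, run code (m x) = Some (m' x).

(** A Hoare triple with a cost bound, quantified existentially over the program. [sub_memory]
    records that earlier results stay available, so facts about them can be transported along a
    sequence of steps. *)
Definition attains (c : nat) m (Q : memory -> Prop) :=
  exists m', [/\ reach c m m', sub_memory m m' & Q m'].

Lemma sub_memory_trans m1 m2 m3 :
  sub_memory m1 m2 -> sub_memory m2 m3 -> sub_memory m1 m3.
Proof. by move=> s12 s23 v /s12/s23. Qed.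

Lemma run_cat (code1 code2 : seq (instr F)) mem :
  run (code1 ++ code2) mem = obind (run code2) (run code1 mem).
Proof. by elim: code1 mem => //= c code1 IH mem; case: (exec _ _). Qed.

Lemma attains_weaken c c' m (Q Q' : memory -> Prop) :
  attains c m Q -> (c <= c')%N -> (forall m', sub_memory m m' -> Q m' -> Q' m') ->
  attains c' m Q'.
Proof.
move=> [m' [[code le_c run_code] sub Qm']] le_cc' QQ'.
by exists m'; split; [exists code => //; apply: leq_trans le_cc' | | apply: QQ'].
Qed.

Lemma attains_ret m (Q : memory -> Prop) : Q m -> attains 0 m Q.
Proof. by move=> Qm; exists m; split => //; exists [::]. Qed.

Lemma attains_bind c d m (Q Q' : memory -> Prop) :
  attains c m Q -> (forall m', sub_memory m m' -> Q m' -> attains d m' Q') ->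
  attains (c + d) m Q'.
Proof.
move=> [m1 [[code1 le_c run1] sub1 Qm1]] /(_ _ sub1 Qm1).
move=> [m2 [[code2 le_d run2] sub2 Qm2]]; exists m2; split => //.
- exists (code1 ++ code2); first by rewrite /cost count_cat leq_add.
  by move=> x; rewrite run_cat run1 /= run2.
- exact: sub_memory_trans sub2.
Qed.

Lemma attains_instr (c : instr F) m v :
  (forall x, exec (m x) c = Some (v x)) -> attains (is_op c) m (fun m' => avail m' v).
Proof.
move=> exec_c.
have sz x : size (rcons (m x) (v x)) = (mem_size m).+1.
  by rewrite size_rcons mem_sizeP.
exists (Memory sz); split.
- exists [:: c]; first by rewrite /cost /= addn0.
  by move=> x /=; rewrite exec_c.
- move=> w [p lt_p wE]; exists p; first exact: ltnW.
  by move=> x /=; rewrite nth_rcons mem_sizeP lt_p.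
- by exists (mem_size m) => // x; rewrite /= nth_rcons mem_sizeP ltnn eqxx.
Qed.

Lemma eq_avail m v w : v =1 w -> avail m v -> avail m w.
Proof. by move=> vw [p lt_p vE]; exists p => // x; rewrite vE vw. Qed.

Lemma attains_const m (a : F) : attains 0 m (fun m' => avail m' (fun=> a)).
Proof. exact: (@attains_instr (Const a)). Qed.

Lemma attains_add m v w : avail m v -> avail m w ->
  attains 1 m (fun m' => avail m' (fun x => v x + w x)).
Proof.
move=> [i _ vE] [j _ wE]; apply: (@attains_instr (Add i j)) => x.
by rewrite /= vE wE.
Qed.

Lemma attains_sub m v w : avail m v -> avail m w ->
  attains 1 m (fun m' => avail m' (fun x => v x - w x)).
Proof.
move=> [i _ vE] [j _ wE]; apply: (@attains_instr (Defs.Sub i j)) => x.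
by rewrite /= vE wE.
Qed.

Lemma attains_mul m v w : avail m v -> avail m w ->
  attains 1 m (fun m' => avail m' (fun x => v x * w x)).
Proof.
move=> [i _ vE] [j _ wE]; apply: (@attains_instr (Mul i j)) => x.
by rewrite /= vE wE.
Qed.

Lemma attains_div m v w : avail m v -> avail m w -> (forall x, w x != 0) ->
  attains 1 m (fun m' => avail m' (fun x => v x / w x)).
Proof.
move=> [i _ vE] [j _ wE] w0; apply: (@attains_instr (Div i j)) => x.
by rewrite /= vE wE (negPf (w0 x)).
Qed.

Lemma attains_iszero m v : avail m v ->
  attains 1 m (fun m' => avail m' (fun x => (v x == 0)%:R)).
Proof. by move=> [i _ vE]; apply: (@attains_instr (IsZero i)) => x; rewrite /= vE. Qed.

(** Loops are unrolled: the number of rounds is fixed when the program is written, and [Q] is the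
    invariant. *)
Lemma attains_loop n c m (Q : nat -> memory -> Prop) :
  Q 0 m ->
  (forall k m', (k < n)%N -> sub_memory m m' -> Q k m' -> attains c m' (Q k.+1)) ->
  attains (n * c) m (Q n).
Proof.
move=> Q0; elim: n => [|n IH] step; first exact: attains_ret.
rewrite mulSn addnC; apply: attains_bind.
  by apply: IH => k m' /ltnW; apply: step.
by move=> m' sub; apply: step.
Qed.

Lemma attains_all n c m (Q : nat -> memory -> Prop) :
  (forall j m1 m2, sub_memory m1 m2 -> Q j m1 -> Q j m2) ->
  (forall k m', (k < n)%N -> sub_memory m m' -> attains c m' (Q k)) ->
  attains (n * c) m (fun m' => forall j, (j < n)%N -> Q j m').
Proof.
move=> mono step.
apply: (@attains_loop _ _ _ (fun k m' => forall j, (j < k)%N -> Q j m')) => // k m'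
  lt_k sub Qk.
apply: attains_weaken (step k m' lt_k sub) (leqnn _) _ => m'' sub' Qm'' j.
rewrite ltnS leq_eqVlt => /predU1P[-> //|lt_j].
exact: mono sub' (Qk j lt_j).
Qed.

Lemma attains_avail_all n c m (v : nat -> I -> F) :
  (forall k m', (k < n)%N -> sub_memory m m' ->
     attains c m' (fun m'' => avail m'' (v k))) ->
  attains (n * c) m (fun m' => forall j, (j < n)%N -> avail m' (v j)).
Proof. by apply: attains_all => j m1 m2 sub /sub. Qed.

Lemma attains_fin (J : finType) c m (v : J -> I -> F) :
  (forall j m', sub_memory m m' -> attains c m' (fun m'' => avail m'' (v j))) ->
  attains (#|J| * c) m (fun m' => forall j, avail m' (v j)).
Proof.
move=> step.
pose Q k m' := forall j : J, enum_rank j = k :> nat -> avail m' (v j).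
apply: attains_weaken (@attains_all #|J| c m Q _ _) (leqnn _) _.
- by move=> k m1 m2 sub Qk j /Qk/sub.
- move=> k m' lt_k sub.
  apply: attains_weaken (step (enum_val (Ordinal lt_k)) m' sub) (leqnn _) _.
  move=> m'' _ av j jk; suff -> : j = enum_val (Ordinal lt_k) by [].
  by apply: enum_rank_inj; rewrite enum_valK; apply: val_inj.
- by move=> m' _ Qm' j; apply: (Qm' (enum_rank j)).
Qed.

(* The operands are relocated one instruction at a time; an operand beyond the
   end of the memory of the callee reads 0, which is why 0 has to be available. *)
Lemma attains_relocate (code : seq (instr F)) m (sm sm' : I -> seq F) k :
  (forall x, size (sm x) = k) -> (forall j, avail m (fun x => (sm x)`_j)) ->
  (forall x, run code (sm x) = Some (sm' x)) ->
  attains (cost code) m (fun m' => forall j, avail m' (fun x => (sm' x)`_j)).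
Proof.
elim: code m sm k => [|c code IH] m sm k szk av run_sm.
  apply: attains_ret => j; apply: eq_avail (av j) => x.
  by have [->] := run_sm x.
have {IH} step v : (forall x, exec (sm x) c = Some (v x)) ->
    attains (is_op c) m (fun m' => avail m' v) ->
    attains (cost (c :: code)) m (fun m' => forall j, avail m' (fun x => (sm' x)`_j)).
  move=> exec_c attains_v; apply: (attains_bind attains_v) => m' sub avv.
  apply: (IH m' (fun x => rcons (sm x) (v x)) k.+1).
  - by move=> x; rewrite size_rcons szk.
  - move=> j; case: (ltngtP j k) => jk.
    + by apply: eq_avail (sub _ (av j)) => x; rewrite nth_rcons szk jk.
    + apply: eq_avail (sub _ (av j)) => x.
      by rewrite nth_rcons szk ltnNge ltnW //= gtn_eqF // nth_default ?szk // ltnW.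
    + by apply: eq_avail avv => x; rewrite nth_rcons szk jk ltnn eqxx.
  - by move=> x; have := run_sm x; rewrite /= exec_c.
case: c run_sm step => [a|i j|i j|i j|i j|i] run_sm step.
- by apply: (step (fun=> a)) => //; apply: attains_const.
- by apply: (step (fun x => (sm x)`_i + (sm x)`_j)) => //; apply: attains_add.
- by apply: (step (fun x => (sm x)`_i - (sm x)`_j)) => //; apply: attains_sub.
- by apply: (step (fun x => (sm x)`_i * (sm x)`_j)) => //; apply: attains_mul.
- have nz x : (sm x)`_j != 0.
    by apply/eqP => z; have := run_sm x; rewrite /= z eqxx.
  apply: (step (fun x => (sm x)`_i / (sm x)`_j)); last exact: attains_div.
  by move=> x; rewrite /= (negPf (nz x)).
- by apply: (step (fun x => ((sm x)`_i == 0)%:R)) => //; apply: attains_iszero.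
Qed.

(** This turns the given programs for products, specified by [computes] on a memory holding only
    their arguments, into subroutines whose arguments may be scattered over a larger memory. *)
Lemma attains_call (code : seq (instr F)) out m (inp outp : I -> seq F) k :
  avail m (fun=> 0) ->
  (forall x, size (inp x) = k) ->
  (forall j, (j < k)%N -> avail m (fun x => (inp x)`_j)) ->
  (forall x, computes code out (inp x) (outp x)) ->
  attains (cost code) m (fun m' => forall j, avail m' (fun x => (outp x)`_j)).
Proof.
move=> av0 szk av run_inp.
have /choice[sm' run_sm'] x : exists mem, run code (inp x) = Some mem /\
    [seq mem`_i | i <- out] = outp x.
  by case: (run_inp x) => mem ? ?; exists mem.
apply: attains_weaken (@attains_relocate code m inp sm' k szk _ _) (leqnn _) _.
- move=> j; case: (ltnP j k) => [/av //|le_kj].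
  by apply: eq_avail av0 => x; rewrite nth_default ?szk.
- by move=> x; have [] := run_sm' x.
move=> m' sub av' j; case: (ltnP j (size out)) => [lt_j|le_j].
  apply: eq_avail (av' (nth 0%N out j)) => x.
  by have [_ <-] := run_sm' x; rewrite (nth_map 0%N).
apply: eq_avail (sub _ av0) => x.
by have [_ <-] := run_sm' x; rewrite nth_default ?size_map.
Qed.

End Programs.

(** * Generalized inverses and kernel vectors *)

Section MatrixPrograms.

Variables (F : fieldType) (I : Type).
Implicit Types (m : memory F I).

Definition availmx m a b (A : I -> 'M[F]_(a, b)) :=
  forall i j, avail m (fun x => A x i j).

Definition matmul_within N c :=
  exists code out, (cost code <= c)%N /\ forall A B : 'M[F]_N,
    computes code out (entries A ++ entries B) (entries (A *m B)).

Lemma availmx_sub m m' a b (A : I -> 'M[F]_(a, b)) :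
  sub_memory m m' -> availmx m A -> availmx m' A.
Proof. by move=> sub avA i j; apply: sub. Qed.

Lemma eq_availmx m a b (A B : I -> 'M[F]_(a, b)) :
  A =1 B -> availmx m A -> availmx m B.
Proof. by move=> AB avA i j; apply: eq_avail (avA i j) => x; rewrite AB. Qed.

Lemma availmx_tr m a b (A : I -> 'M[F]_(a, b)) :
  availmx m A -> availmx m (fun x => (A x)^T).
Proof. by move=> avA i j; apply: eq_avail (avA j i) => x; rewrite mxE. Qed.

Lemma availmx_row m a b c (A : I -> 'M[F]_(a, b)) (B : I -> 'M[F]_(a, c)) :
  availmx m A -> availmx m B -> availmx m (fun x => row_mx (A x) (B x)).
Proof.
move=> avA avB i j; case: (split_ordP j) => k ->.
  by apply: eq_avail (avA i k) => x; rewrite row_mxEl.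
by apply: eq_avail (avB i k) => x; rewrite row_mxEr.
Qed.

Lemma availmx_usub m a b c (A : I -> 'M[F]_(a + b, c)) :
  availmx m A -> availmx m (fun x => usubmx (A x)).
Proof. by move=> avA i j; apply: eq_avail (avA (lshift b i) j) => x; rewrite mxE. Qed.

Lemma availmx_dsub m a b c (A : I -> 'M[F]_(a + b, c)) :
  availmx m A -> availmx m (fun x => dsubmx (A x)).
Proof. by move=> avA i j; apply: eq_avail (avA (rshift a i) j) => x; rewrite mxE. Qed.

(** Multiplying by [pid_mx] only keeps entries or replaces them by 0, so padding and truncating cost
    no instruction. *)
Lemma availmx_pidl m r a' a b (A : I -> 'M[F]_(a, b)) :
  avail m (fun=> 0) -> availmx m A ->
  availmx m (fun x => (pid_mx r : 'M_(a', a)) *m A x).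
Proof.
move=> av0 avA i j.
have [k|no_k] := pickP (fun k : 'I_a => (i == k :> nat) && (i < r)%N).
  case/andP=> ik ir; apply: eq_avail (avA k j) => x.
  rewrite mxE (bigD1 k) //= mxE ik ir mul1r big1 ?addr0 // => l lk.
  rewrite mxE; case: eqP => [il|]; rewrite ?mul0r //.
  by case/eqP: lk; apply: val_inj; rewrite /= -il (eqP ik).
apply: eq_avail av0 => x; rewrite mxE big1 // => k _.
by rewrite mxE no_k mul0r.
Qed.

Lemma availmx_pidr m r a b b' (A : I -> 'M[F]_(a, b)) :
  avail m (fun=> 0) -> availmx m A ->
  availmx m (fun x => A x *m (pid_mx r : 'M_(b, b'))).
Proof.
move=> av0 avA.
apply: (eq_availmx (A := fun x => ((pid_mx r : 'M_(b', b)) *m (A x)^T)^T)).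
  by move=> x; rewrite trmx_mul trmxK tr_pid_mx.
by apply/availmx_tr/availmx_pidl/availmx_tr.
Qed.

Lemma attains_mx m a b c (A : I -> 'M[F]_(a, b)) :
  (forall i j m', sub_memory m m' ->
     attains c m' (fun m'' => avail m'' (fun x => A x i j))) ->
  attains (a * b * c) m (fun m' => availmx m' A).
Proof.
move=> step.
have := @attains_fin F I ('I_a * 'I_b)%type c m (fun ij x => A x ij.1 ij.2).
rewrite card_prod !card_ord => step'.
by apply: attains_weaken (step' _) (leqnn _) _ => [[i j] | m' _ av i j];
  [exact: step | exact: (av (i, j))].
Qed.

Lemma attains_submx m a b (A B : I -> 'M[F]_(a, b)) :
  availmx m A -> availmx m B ->
  attains (a * b) m (fun m' => availmx m' (fun x => A x - B x)).
Proof.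
move=> avA avB; rewrite -[(a * b)%N]muln1; apply: attains_mx => i j m' sub.
apply: attains_weaken (attains_sub (sub _ (avA i j)) (sub _ (avB i j))) (leqnn _) _.
by move=> m'' _; apply: eq_avail => x; rewrite !mxE.
Qed.

Section EntriesIndex.

Variable N : nat.

(** [entries] reads every matrix along this one list, so the position of an entry does not depend on
    the matrix. *)
Definition entry_index : seq ('I_N * 'I_N) :=
  [seq (i, j) | i <- enum 'I_N, j <- enum 'I_N].

Lemma entriesE (A : 'M[F]_N) : entries A = [seq A ij.1 ij.2 | ij <- entry_index].
Proof. by rewrite map_allpairs. Qed.

Lemma nth_entries p : (p < size entry_index)%N ->
  exists i j, forall A : 'M[F]_N, (entries A)`_p = A i j.
Proof.
move=> lt_p; have [x0 _] : exists x0 : 'I_N * 'I_N, true.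
  by case: (entry_index) lt_p => // x0; exists x0.
exists (nth x0 entry_index p).1, (nth x0 entry_index p).2 => A.
by rewrite entriesE (nth_map x0).
Qed.

Lemma entries_nth (i j : 'I_N) :
  exists p, forall A : 'M[F]_N, (entries A)`_p = A i j.
Proof.
have ij : (i, j) \in entry_index by rewrite allpairs_f ?mem_enum.
exists (index (i, j) entry_index) => A.
by rewrite entriesE (nth_map (i, j)) ?index_mem // nth_index.
Qed.

End EntriesIndex.

Lemma attains_mulmx_sq N c m (A B : I -> 'M[F]_N) :
  matmul_within N c -> availmx m A -> availmx m B ->
  attains c m (fun m' => availmx m' (fun x => A x *m B x)).
Proof.
move=> [code [out [le_c run_code]]] avA avB.
rewrite -[c]add0n; apply: attains_bind (attains_const m 0) _ => m' sub av0.
have szE (X : 'M[F]_N) : size (entries X) = size (entry_index N).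
  by rewrite entriesE size_map.
apply: attains_weaken (@attains_call _ _ code out m'
   (fun x => entries (A x) ++ entries (B x)) (fun x => entries (A x *m B x))
   (size (entry_index N) + size (entry_index N)) av0 _ _ _) le_c _.
- by move=> x; rewrite size_cat !szE.
- move=> p lt_p; case: (ltnP p (size (entry_index N))) => [lt|le].
    have [i [j nthE]] := nth_entries lt.
    by apply: eq_avail (sub _ (avA i j)) => x; rewrite nth_cat szE lt nthE.
  have lt : (p - size (entry_index N) < size (entry_index N))%N by rewrite ltn_subLR.
  have [i [j nthE]] := nth_entries lt.
  apply: eq_avail (sub _ (avB i j)) => x.
  by rewrite nth_cat szE ltnNge le /= nthE.
- by [].
move=> m'' _ av i j; have [p nthE] := entries_nth i j.
by apply: eq_avail (av p) => x; rewrite nthE.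
Qed.

Lemma mul_pid_mx_id a N : (a <= N)%N ->
  (pid_mx a : 'M[F]_(a, N)) *m (pid_mx a : 'M_(N, a)) = 1%:M.
Proof. by move=> leaN; rewrite mul_pid_mx minnn (minn_idPr leaN) pid_mx_1. Qed.

(** The factors are padded with zeros to N x N, and the block of interest is cut out of the square
    product. *)
Lemma attains_mulmx N a b d c m (A : I -> 'M[F]_(a, b)) (B : I -> 'M[F]_(b, d)) :
  matmul_within N c -> (a <= N)%N -> (b <= N)%N -> (d <= N)%N ->
  availmx m A -> availmx m B ->
  attains c m (fun m' => availmx m' (fun x => A x *m B x)).
Proof.
move=> mmN leaN lebN ledN avA avB.
rewrite -[c]addn0 -[c]add0n -addnA; apply: attains_bind (attains_const m 0) _ => m0
  sub0 av0.
pose A' x : 'M_N := pid_mx a *m A x *m pid_mx b.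
pose B' x : 'M_N := pid_mx b *m B x *m pid_mx d.
apply: attains_bind (@attains_mulmx_sq N c m0 A' B' mmN _ _) _.
- by apply/availmx_pidr/availmx_pidl/(availmx_sub sub0 avA).
- by apply/availmx_pidr/availmx_pidl/(availmx_sub sub0 avB).
move=> m1 sub1 avAB; apply: attains_ret.
apply: (eq_availmx (A := fun x => pid_mx a *m (A' x *m B' x) *m pid_mx d)).
  move=> x; rewrite /A' /B' !mulmxA mul_pid_mx_id // mul1mx.
  by rewrite -[A x *m _ *m _]mulmxA mul_pid_mx_id // mulmx1 -mulmxA mul_pid_mx_id // mulmx1.
by apply/availmx_pidr/availmx_pidl => //; apply: sub1.
Qed.

Definition ginv_within a b c := forall m (A : I -> 'M[F]_(a, b)), availmx m A ->
  attains c m (fun m' => exists2 G : I -> 'M[F]_(b, a), availmx m' G &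
    forall x, A x *m G x *m A x = A x).

(** Transposition lets a single doubling lemma, for rows, serve for columns as well. *)
Lemma ginv_tr a b c : ginv_within a b c -> ginv_within b a c.
Proof.
move=> ginv m A avA.
apply: attains_weaken (ginv m _ (availmx_tr avA)) (leqnn _) _ => m' _ [G avG AGA].
exists (fun x => (G x)^T); first exact: availmx_tr.
by move=> x; apply: trmx_inj; rewrite !trmx_mul trmxK mulmxA AGA.
Qed.

(* With P the projector [T^- T], the generalized inverse of the rows T stacked on
   the rows B is computed from those of T and of the residue [B (1 - P)]. *)
Lemma ginv_col_mx n k (T B : 'M[F]_(n, k)) (Ti H : 'M[F]_(k, n)) :
  let BF := B - B *m (Ti *m T) in let FH := H - Ti *m T *m H in
  T *m Ti *m T = T -> BF *m H *m BF = BF ->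
  col_mx T B *m row_mx (Ti - FH *m (B *m Ti)) FH *m col_mx T B = col_mx T B.
Proof.
move=> BF FH TTT BHB.
have TFH : T *m FH = 0 by rewrite /FH mulmxBr !mulmxA TTT subrr.
have BFH : B *m FH = BF *m H by rewrite /FH /BF mulmxBr mulmxBl !mulmxA.
rewrite -mulmxA mul_col_mx; set C := row_mx _ _ *m _.
(* The product is the projector plus a correction annihilated by T, so the rows T are reproduced by
   the projector alone and the correction only has to restore the residue of B. *)
have -> : C = Ti *m T + FH *m BF.
  by rewrite /C mul_row_col mulmxBl /BF mulmxBr !mulmxA -addrA [- _ + _]addrC.
congr (col_mx _ _); rewrite mulmxDr !mulmxA.
  by rewrite TTT TFH mul0mx addr0.
by rewrite BFH BHB /BF mulmxA addrC subrK.
Qed.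

(** The five products are P = Ti T, B P, P H, B Ti and FH (B Ti); the three subtractions form B - B
    P, FH = H - P H and Ti - FH (B Ti). Every matrix involved fits in N x N. *)
Lemma ginv_double N n k cmul c :
  matmul_within N cmul -> (n <= N)%N -> (k <= N)%N -> ginv_within n k c ->
  ginv_within (n + n) k (c + c + 5 * cmul + 3 * (N * N)).
Proof.
move=> mmN nN kN ginv m A avA.
set T := fun x => usubmx (A x); set B := fun x => dsubmx (A x).
have avT : availmx m T by apply: availmx_usub.
have avB : availmx m B by apply: availmx_dsub.
have ->: (c + c + 5 * cmul + 3 * (N * N) = c + (cmul + (cmul + (N * N + (c + (cmul +
   (N * N + (cmul + (cmul + (N * N + 0))))))))))%N by lia.
have knN : (k * n <= N * N)%N by rewrite leq_mul.
apply: attains_bind (ginv m T avT) _ => m1 s1 [Ti avTi TTT].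
apply: attains_bind (attains_mulmx mmN kN nN kN avTi (availmx_sub s1 avT)) _ => m2 s2 avP.
have sB := availmx_sub (sub_memory_trans s1 s2) avB.
apply: attains_bind (attains_mulmx mmN nN kN kN sB avP) _ => m3 s3 avBP.
apply: attains_bind (attains_weaken (attains_submx (availmx_sub s3 sB) avBP) _ (fun _ _
  h => h)) _.
  by rewrite mulnC.
move=> m4 s4 avBF.
apply: attains_bind (ginv m4 _ avBF) _ => m5 s5 [H avH BHB].
have s25 := sub_memory_trans s3 (sub_memory_trans s4 s5).
apply: attains_bind (attains_mulmx mmN kN kN nN (availmx_sub s25 avP) avH) _ => m6 s6 avPH.
apply: attains_bind (attains_weaken (attains_submx (availmx_sub s6 avH) avPH) knN (fun
  _ _ h => h)) _.
move=> m7 s7 avFH.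
have s27 := sub_memory_trans s25 (sub_memory_trans s6 s7).
have avTi7 := availmx_sub (sub_memory_trans s2 s27) avTi.
apply: attains_bind (attains_mulmx mmN nN kN nN (availmx_sub s27 sB) avTi7) _ => m8 s8
  avBTi.
apply: attains_bind (attains_mulmx mmN kN nN nN (availmx_sub s8 avFH) avBTi) _ => m9 s9
  avFHBTi.
have s79 := sub_memory_trans s8 s9.
apply: attains_bind (attains_weaken (attains_submx (availmx_sub s79 avTi7) avFHBTi) knN
  (fun _ _ h => h)) _.
move=> m10 s10 avX; apply: attains_ret.
eexists; first exact: availmx_row avX (availmx_sub (sub_memory_trans s79 s10) avFH).
by move=> x; rewrite -[A x]vsubmxK; apply: (ginv_col_mx (TTT x) (BHB x)).
Qed.

(** With z the zero test of a, the quotient (1 - z) / (a + z) is 1/a or 0, and its denominator never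
    vanishes. *)
Lemma ginv_scalar : ginv_within 1 1 4.
Proof.
move=> m A avA.
rewrite -[4%N]/(0 + (1 + (1 + (1 + (1 + 0)))))%N.
apply: attains_bind (attains_const m 1) _ => m1 s1 av1.
apply: attains_bind (attains_iszero (s1 _ (avA 0 0))) _ => m2 s2 avz.
apply: attains_bind (attains_sub (s2 _ av1) avz) _ => m3 s3 avn.
apply: attains_bind (attains_add (s3 _ (s2 _ (s1 _ (avA 0 0)))) (s3 _ avz)) _ => m4 s4 avd.
apply: attains_bind (attains_div (s4 _ avn) avd _) _.
  move=> x; have [->|nz] := eqVneq (A x 0 0) 0; first by rewrite add0r oner_eq0.
  by rewrite addr0.
move=> m5 s5 avq; apply: attains_ret.
exists (fun x => ((1 - (A x 0 0 == 0)%:R) / (A x 0 0 + (A x 0 0 == 0)%:R))%:M).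
  by move=> i j; apply: eq_avail avq => x; rewrite !ord1 mxE eqxx mulr1n.
move=> x; rewrite [A x]mx11_scalar -!scalar_mxM; congr (_%:M).
have [->|nz] := eqVneq (A x 0 0) 0; first by rewrite mulr0.
by rewrite !mxE eqxx mulr1n (negPf nz) subr0 addr0 div1r mulfV // mul1r.
Qed.

(** The power 2^t in a form that unfolds to a sum n + n, so that block matrices have the right type
    without casts. *)
Fixpoint double_iter t := if t is t'.+1 then (double_iter t' + double_iter t')%N else 1%N.

Lemma double_iterE t : double_iter t = (2 ^ t)%N.
Proof. by elim: t => //= t ->; rewrite addnn expnS mul2n. Qed.

(** Doubling the rows uses two recursive calls and one overhead; doubling the columns does this
    twice and adds one overhead of its own, hence the factors 4 and 3. *)
Fixpoint ginv_cost (cmul : nat -> nat) t :=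
  if t is t'.+1 then
    (4 * ginv_cost cmul t' + 3 * (5 * cmul t + 3 * (2 ^ t * 2 ^ t)))%N
  else 4%N.

Lemma ginv_square cmul t :
  (forall u, matmul_within (double_iter u) (cmul u)) ->
  ginv_within (double_iter t) (double_iter t) (ginv_cost cmul t).
Proof.
move=> mm; elim: t => [|t IH]; first exact: ginv_scalar.
have le1 : (double_iter t <= double_iter t.+1)%N by rewrite leq_addr.
have := ginv_double (mm t.+1) le1 le1 IH.
move/ginv_tr/(ginv_double (mm t.+1) le1 (leqnn _)) => H m A /H.
by move/attains_weaken; apply=> //; rewrite ?double_iterE [ginv_cost _ _.+1]/=; lia.
Qed.

(** Cutting down a generalized inverse of the zero-padded matrix P A Q leaves one of A, because Q P
    = 1. *)
Lemma ginv_shrink N r c : (r <= N)%N -> ginv_within N N c -> ginv_within r r c.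
Proof.
move=> rN ginv m A avA; rewrite -[c]addn0 -[c]add0n -addnA.
apply: attains_bind (attains_const m 0) _ => m0 s0 av0.
pose A' x : 'M_N := pid_mx r *m A x *m pid_mx r.
apply: attains_bind (ginv m0 A' _) _.
  by apply/availmx_pidr/availmx_pidl/(availmx_sub s0 avA).
move=> m1 s1 [G avG AGA]; apply: attains_ret.
exists (fun x => pid_mx r *m G x *m pid_mx r).
  by apply/availmx_pidr/availmx_pidl => //; apply: s1.
move=> x; set Q := (pid_mx r : 'M_(r, N)); set P := (pid_mx r : 'M_(N, r)).
have QP : Q *m P = 1%:M by apply: mul_pid_mx_id.
transitivity (Q *m (A' x *m G x *m A' x) *m P); last first.
  by rewrite AGA /A' -/Q -/P !mulmxA QP mul1mx -mulmxA QP mulmx1.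
by rewrite /A' -/Q -/P !mulmxA QP mul1mx -[RHS]mulmxA QP mulmx1.
Qed.

Lemma attains_zero_flag n m (v : nat -> I -> F) :
  (forall i, (i < n)%N -> avail m (v i)) ->
  attains (n * 2) m (fun m' => avail m' (fun x => [forall i : 'I_n, v i x == 0]%:R)).
Proof.
move=> avv; rewrite -[(n * 2)%N]add0n.
apply: attains_bind (attains_const m 1) _ => m1 s1 av1.
pose Q k m' := avail m' (fun x => \prod_(i < k) (v i x == 0)%:R).
apply: attains_weaken (attains_loop (Q := Q) _ _) (leqnn _) _.
- by apply: eq_avail av1 => x; rewrite big_ord0.
- move=> k m2 lt_k s2 Qk; rewrite -[2%N]/(1 + 1)%N.
  apply: attains_bind (attains_iszero (s2 _ (s1 _ (avv k lt_k)))) _ => m3 s3 avz.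
  apply: attains_weaken (attains_mul (s3 _ Qk) avz) (leqnn _) _ => m4 _.
  by apply: eq_avail => x; rewrite big_ord_recr.
move=> m2 _; apply: eq_avail => x; case: forallP => [all0|/forallP].
  by rewrite big1 // => i _; rewrite all0.
by rewrite negb_forall => /existsP[i nz]; rewrite (bigD1 i) //= (negPf nz) mul0r.
Qed.

(* The first nonzero column of [1 - G A] is selected by arithmetic on zero tests. *)
Lemma attains_kernel N r cginv cmul m (A : I -> 'M[F]_r.+1) :
  (r.+1 <= N)%N -> matmul_within N cmul -> ginv_within r.+1 r.+1 cginv ->
  availmx m A -> (forall x, exists2 v : 'cV_r.+1, v != 0 & A x *m v = 0) ->
  attains (cginv + cmul + 5 * (r.+1 * r.+1)) m (fun m' =>
    exists2 v : I -> 'cV_r.+1, availmx m' v & forall x, v x != 0 /\ A x *m v x = 0).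
Proof.
move=> rN mmN ginv avA singA; set n := r.+1.
have -> : (cginv + cmul + 5 * (n * n) =
   0 + (0 + (cginv + (cmul + (n * n + (n * (n * 2 + n * 1 * 2) + 0))))))%N by lia.
apply: attains_bind (attains_const m 0) _ => m0 s0 av0.
apply: attains_bind (attains_const m0 1) _ => m1 s1 av1.
have s01 := sub_memory_trans s0 s1.
apply: attains_bind (ginv m1 A (availmx_sub s01 avA)) _ => m2 s2 [G avG AGA].
have s02 := sub_memory_trans s01 s2.
apply: attains_bind (attains_mulmx mmN rN rN rN avG (availmx_sub s02 avA)) _ => m3 s3 avGA.
have av1M : availmx m3 (fun=> 1%:M : 'M[F]_n).
  move=> i j; case: (eqVneq i j) => [->|ij].
    by apply: eq_avail (s3 _ (s2 _ av1)) => x; rewrite mxE eqxx.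
  by apply: eq_avail (s3 _ (s2 _ (s1 _ av0))) => x; rewrite mxE (negPf ij).
apply: attains_bind (attains_submx av1M avGA) _ => m4 s4 avK.
set K := fun x => 1%:M - G x *m A x.
have AK x : A x *m K x = 0 by rewrite mulmxBr mulmx1 mulmxA AGA subrr.
(* After k rounds v lies in the kernel of A, and it is zero only if the first k columns of K = 1 - G
   A all vanish. *)
pose Q k m' := exists2 v : I -> 'cV[F]_n, availmx m' v &
  forall x, A x *m v x = 0 /\ (v x = 0 -> forall j : 'I_n, (j < k)%N -> col j (K x) = 0).
apply: attains_bind (attains_loop (Q := Q) _ _) _; last first.
  move=> m5 s5 [v avv vP]; apply: attains_ret; exists v => // x.
  have [Av0 v0K] := vP x; split => //; apply/eqP => v0.
  have K0 : K x = 0.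
    by apply/matrixP => i j; have /colP/(_ i) := v0K v0 j (ltn_ord j); rewrite !mxE.
  (* If K were zero then G A = 1 and A would be injective. *)
  have [w w0 Aw0] := singA x; case/eqP: w0.
  by have := subr0_eq K0 => /(congr1 (mulmxr w)); rewrite /= mul1mx -mulmxA Aw0 mulmx0.
- move=> k m5 lt_k s5 [v avv vP]; pose j0 : 'I_n := Ordinal lt_k.
  apply: attains_bind (attains_zero_flag (n := n) (v := fun i x => v x (inord i) 0) _) _.
    by move=> i _; apply: avv.
  move=> m6 s6 avz;
  have zE x : [forall i : 'I_n, v x (inord i) 0 == 0] = (v x == 0).
    apply/forallP/eqP => [v0 | -> i]; last by rewrite mxE.
    by apply/colP => i; have /eqP := v0 i; rewrite inord_val mxE.
  (* The new column is added only while v is still zero. *)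
  pose v' x := v x + (v x == 0)%:R *: col j0 (K x).
  apply: attains_weaken (attains_mx (A := v') (c := 2) _) (leqnn _) _.
    move=> i j m7 s7; rewrite -[2%N]/(1 + (1 + 0))%N.
    apply: attains_bind (attains_mul (s7 _ avz) (s7 _ (s6 _ (s5 _ (avK i j0))))) _ =>
      m8 s8 avzK.
    apply: attains_bind (attains_add (s8 _ (s7 _ (s6 _ (avv i j)))) avzK) _ => m9 s9 avs.
    by apply: attains_ret; apply: eq_avail avs => x; rewrite zE !mxE.
  move=> m7 s7 avv'; exists v' => // x; have [Av0 v0K] := vP x; split.
    rewrite mulmxDr Av0 add0r -scalemxAr colE mulmxA AK mul0mx scaler0 //.
  rewrite /v'; have [v0|nz] := eqVneq (v x) 0; last first.
    by rewrite scale0r addr0 => /eqP; rewrite (negPf nz).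
  rewrite v0 add0r scale1r => Kj0 j; rewrite ltnS leq_eqVlt => /predU1P[jk|]; last
    exact: v0K.
  by have -> : j = j0 by apply: val_inj.
exists (fun=> 0); first by move=> i j; apply: eq_avail (s4 _ (s3 _ (s2 _ (s1 _ av0))))
  => x; rewrite mxE.
by move=> x; split; first rewrite mulmx0.
Qed.

End MatrixPrograms.

(** * Arithmetic modulo a monic polynomial *)

Section Barrett.

Variables (F : fieldType) (r : nat) (f : {poly F}).
Hypotheses (r_gt0 : (0 < r)%N) (f_monic : f \is monic) (f_size : size f = r.+1).

Lemma size_mod_monic (p : {poly F}) : (size (p %% f)%R <= r)%N.
Proof. by rewrite -ltnS -f_size ltn_modp monic_neq0. Qed.

Lemma size_X_mod (p : {poly F}) : (size p <= r)%N ->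
  (size (p * 'X - p`_r.-1 *: f)%R <= r)%N.
Proof.
move=> sp; apply/leq_sizeP => j le_rj; rewrite coefB coefMX coefZ.
have -> : (j == 0%N) = false by apply/eqP; lia.
case: (ssrnat.ltngtP r j) le_rj => // [lt_rj|<-] _.
  rewrite [p`_j.-1]nth_default; last by apply: leq_trans sp _; lia.
  by rewrite [f`_j]nth_default ?f_size // mulr0 subr0.
have -> : f`_r = 1 by rewrite -(monicP f_monic) lead_coefE f_size.
by rewrite mulr1 subrr.
Qed.

(** One step of long division: the next coefficient of the quotient is the top coefficient of the
    current remainder. *)
Lemma Xn_divmodS n (c := ('X^n %% f)`_r.-1) :
  'X^(n.+1) %/ f = ('X^n %/ f) * 'X + c%:P /\ 'X^(n.+1) %% f = ('X^n %% f) * 'X - c *: f.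
Proof.
have E : 'X^(n.+1) = (('X^n %/ f) * 'X + c%:P) * f + (('X^n %% f) * 'X - c *: f).
  rewrite exprSr {1}(divp_eq 'X^n f) mulrDl mulrDl -mul_polyC.
  by rewrite [_ - _]addrC addrA addrK mulrAC.
have sz : (size (('X^n %% f) * 'X - c *: f)%R < size f)%N.
  by rewrite f_size ltnS size_X_mod // size_mod_monic.
by rewrite -(divpP E sz) -(modpP E sz).
Qed.

Lemma size_Xn_div : (size ('X^((r + r).-1) %/ f)%R <= r)%N.
Proof. by rewrite size_divp ?monic_neq0 // f_size size_polyXn; lia. Qed.

(* Barrett reduction: the quotient by [f] is read off a product with the fixed
   polynomial X^(2r-1) / f, exactly. *)
Lemma barrett_div (c : {poly F}) : (size c <= (r + r).-1)%N ->
  c %/ f = drop_poly r.-1 (drop_poly r c * ('X^((r + r).-1) %/ f)).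
Proof.
move=> sc; set u := drop_poly r c; set B := 'X^((r + r).-1) %/ f; set w := drop_poly
  r.-1 (u * B).
have su : (size u <= r.-1)%N by rewrite size_drop_poly; lia.
set v := take_poly r.-1 (u * B); set c0 := take_poly r c; set R := 'X^((r + r).-1) %% f.
(* All three terms on the right have size at most 2r-1, so c - w f has size at most r and w is
   exactly the quotient: no final correction is required. *)
have E : (c - w * f) * 'X^(r.-1) = v * f + u * R + c0 * 'X^(r.-1).
  have cE : c * 'X^(r.-1) = c0 * 'X^(r.-1) + u * 'X^((r + r).-1).
    rewrite -[in LHS](poly_take_drop r c) mulrDl -/c0 -/u -mulrA -exprD.
    by congr (_ + _ * 'X^_); lia.
  have uB : u * B = v + w * 'X^(r.-1) by rewrite /v /w poly_take_drop.
  rewrite mulrBl cE (divp_eq 'X^((r + r).-1) f) -/B -/R mulrDr mulrA uB.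
  by rewrite mulrAC mulrDl; ring.
have size_prod (p q : {poly F}) a b : (size p <= a)%N -> (size q <= b)%N ->
    ((a + b).-1 <= (r + r).-1)%N -> (size (p * q)%R <= (r + r).-1)%N.
  move=> sp sq; apply: leq_trans; apply: leq_trans (size_polyMleq _ _) _.
  by rewrite -!subn1 leq_sub2r // leq_add.
have sE : (size ((c - w * f) * 'X^(r.-1))%R <= (r + r).-1)%N.
  rewrite E; apply: leq_trans (size_polyD _ _) _; rewrite geq_max; apply/andP; split.
    apply: leq_trans (size_polyD _ _) _; rewrite geq_max; apply/andP; split.
      by apply: size_prod (size_take_poly _ _) (eq_leq f_size) _; lia.
    by apply: size_prod su (size_mod_monic _) _; lia.
  by apply: size_prod (size_take_poly _ _) (eq_leq (size_polyXn _ _)) _; lia.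
apply/esym/(@divpP _ _ _ _ (c - w * f)); first by rewrite addrC subrK.
rewrite f_size ltnS; have [->|nz] := eqVneq (c - w * f) 0; first by rewrite size_poly0.
by move: sE; rewrite size_mulXn //; lia.
Qed.

(** The divisor has r+1 coefficients, one too many for a product of size r. Its leading term only
    affects coefficients from X^r on, which the truncation discards. *)
Lemma barrett_mod (c : {poly F}) : (size c <= (r + r).-1)%N ->
  c %% f = take_poly r (c - (c %/ f) * take_poly r f).
Proof.
move=> sc; rewrite -[LHS](take_poly_id (size_mod_monic c)).
have -> : c - c %/ f * take_poly r f = c %% f + c %/ f * drop_poly r f * 'X^r.
  rewrite {1}(divp_eq c f) -mulrA -[X in _ * X + _ - _](poly_take_drop r f).
  by ring.
apply/polyP => i; rewrite !coef_take_poly; case: ifP => // ir.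
by rewrite coefD coefMXn ir addr0.
Qed.

End Barrett.

(** * Programs for products, reductions and powers of polynomials *)

Section PolyPrograms.

Variables (F : fieldType) (I : Type).
Implicit Types (m : memory F I) (P Q : I -> {poly F}).

(** Indices beyond the degree are included and read a stored 0; shifts and truncations then cost
    nothing. *)
Definition availp m P := forall j, avail m (fun x => (P x)`_j).

Definition polymul_within r c :=
  exists code out, (cost code <= c)%N /\ forall a b : {poly F},
    (size a <= r)%N -> (size b <= r)%N ->
    computes code out (coefs r a ++ coefs r b) (coefs (r + r).-1 (a * b)).

Lemma availp_sub m m' P : sub_memory m m' -> availp m P -> availp m' P.
Proof. by move=> sub avP j; apply: sub. Qed.

Lemma eq_availp m P Q : P =1 Q -> availp m P -> availp m Q.
Proof. by move=> PQ avP j; apply: eq_avail (avP j) => x; rewrite PQ. Qed.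

Lemma availp_drop m n P : availp m P -> availp m (fun x => drop_poly n (P x)).
Proof. by move=> avP j; apply: eq_avail (avP (j + n)%N) => x; rewrite coef_drop_poly. Qed.

Lemma availp_take m n P : avail m (fun=> 0) -> availp m P ->
  availp m (fun x => take_poly n (P x)).
Proof.
move=> av0 avP j; case: (ltnP j n) => jn.
  by apply: eq_avail (avP j) => x; rewrite coef_take_poly jn.
by apply: eq_avail av0 => x; rewrite coef_take_poly ltnNge jn.
Qed.

Lemma availp_const m (p : {poly F}) :
  (forall i, (i < size p)%N -> avail m (fun=> p`_i)) -> avail m (fun=> 0) ->
  availp m (fun=> p).
Proof.
move=> avp av0 j; case: (ltnP j (size p)) => [|le]; first exact: avp.
by apply: eq_avail av0 => x; rewrite nth_default.
Qed.

Lemma attains_poly n c m P :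
  avail m (fun=> 0) -> (forall x, (size (P x) <= n)%N) ->
  (forall j m', (j < n)%N -> sub_memory m m' ->
    attains c m' (fun m'' => avail m'' (fun x => (P x)`_j))) ->
  attains (n * c) m (fun m' => availp m' P).
Proof.
move=> av0 szP step.
apply: attains_weaken (attains_avail_all (v := fun j x => (P x)`_j) _) (leqnn _) _.
  by move=> k m' lt_k sub; apply: step.
move=> m' sub av j; case: (ltnP j n) => [/av //|le_nj].
by apply: eq_avail (sub _ av0) => x; rewrite nth_default // (leq_trans (szP x)).
Qed.

Lemma attains_polymul r c m P Q :
  polymul_within r c -> (0 < r)%N ->
  (forall x, size (P x) <= r)%N -> (forall x, size (Q x) <= r)%N ->
  avail m (fun=> 0) -> availp m P -> availp m Q ->
  attains c m (fun m' => availp m' (fun x => P x * Q x)).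
Proof.
move=> [code [out [le_c run_code]]] r_gt0 szP szQ av0 avP avQ.
apply: attains_weaken (attains_call (code := code) (out := out)
   (inp := fun x => coefs r (P x) ++ coefs r (Q x)) (k := (r + r)%N)
   (outp := fun x => coefs (r + r).-1 (P x * Q x)) av0 _ _ _) le_c _.
- by move=> x; rewrite size_cat !size_mkseq.
- move=> j lt_j; case: (ltnP j r) => jr.
    by apply: eq_avail (avP j) => x; rewrite nth_cat size_mkseq jr nth_mkseq.
  apply: eq_avail (avQ (j - r)%N) => x.
  by rewrite nth_cat size_mkseq ltnNge jr /= nth_mkseq //; lia.
- by move=> x; apply: run_code.
move=> m' sub av j; case: (ltnP j (r + r).-1) => jr.
  by apply: eq_avail (av j) => x; rewrite nth_mkseq.
apply: eq_avail (sub _ av0) => x; rewrite nth_default //.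
by apply: leq_trans jr; apply: leq_trans (size_polyMleq _ _) _; rewrite -!subn1
  leq_sub2r // leq_add.
Qed.

Lemma attains_lincomb n r m (c : nat -> I -> F) (P : nat -> I -> {poly F}) :
  avail m (fun=> 0) ->
  (forall j, (j < n)%N -> avail m (c j)) -> (forall j, (j < n)%N -> availp m (P j)) ->
  (forall j x, (j < n)%N -> size (P j x) <= r)%N ->
  attains (n * (r * 2)) m (fun m' => availp m' (fun x => \sum_(j < n) c j x *: P j x)).
Proof.
move=> av0 avc avP szP.
apply: (@attains_loop _ _ n _ _ (fun k m' => availp m' (fun x => \sum_(j < k) c j x *:
  P j x))).
  by move=> j; apply: eq_avail av0 => x; rewrite big_ord0 coef0.
move=> k m1 lt_k s1 avS; apply: attains_poly; first exact: s1.
  move=> x; apply: leq_trans (size_sum _ _ _) _; apply/bigmax_leqP => j _.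
  apply: leq_trans (size_scale_leq _ _) _; apply: szP.
  by apply: leq_ltn_trans lt_k; rewrite -ltnS.
move=> j m2 lt_j s2; rewrite -[2%N]/(1 + 1)%N.
apply: attains_bind (attains_mul (s2 _ (s1 _ (avc k lt_k))) (s2 _ (s1 _ (avP k lt_k j)))) _.
move=> m3 s3 avM; apply: attains_weaken (attains_add (s3 _ (s2 _ (avS j))) avM) (leqnn _) _.
by move=> m4 _; apply: eq_avail => x; rewrite big_ord_recr coefD coefZ.
Qed.

Section ModMonic.

Variables (r c : nat) (f : I -> {poly F}).
Hypotheses (r_gt0 : (0 < r)%N) (mulr : polymul_within r c).
Hypotheses (f_monic : forall x, f x \is monic) (f_size : forall x, size (f x) = r.+1).

Definition barrett_poly x : {poly F} := 'X^((r + r).-1) %/ f x.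

Lemma attains_barrett m : avail m (fun=> 0) -> availp m f ->
  attains (r * r * 4) m (fun m' => availp m' barrett_poly).
Proof.
move=> av0 avf; rewrite -[(r * r * 4)%N]add0n.
apply: attains_bind (attains_const m 1) _ => m1 s1 av1.
pose Q k m' := availp m' (fun x => 'X^k %/ f x) /\ availp m' (fun x => 'X^k %% f x).
have sz1 x : (size ('X^0 : {poly F}) < size (f x))%N.
  by rewrite expr0 size_polyC oner_eq0 f_size ltnS.
apply: attains_weaken (attains_loop (n := (r + r).-1) (c := (r * 2)%N) (Q := Q) _ _) _ _.
- split => j.
    by apply: eq_avail (s1 _ av0) => x; rewrite divp_small // coef0.
  case: (eqVneq j 0%N) => [->|j0].
    by apply: eq_avail av1 => x; rewrite modp_small // coefXn.
  by apply: eq_avail (s1 _ av0) => x; rewrite modp_small // coefXn (negPf j0).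
- move=> k m2 _ s2 [avD avM].
  (* The new quotient costs no operation: it is the old one shifted, with a coefficient of the
     remainder put in front. Only the remainder is computed. *)
  have avS : availp m2 (fun x => 'X^(k.+1) %/ f x).
    move=> [|j].
      apply: eq_avail (avM r.-1) => x.
      by have [-> _] := Xn_divmodS r_gt0 (f_monic x) (f_size x) k; rewrite coefD coefMX
        coefC add0r.
    apply: eq_avail (avD j) => x.
    by have [-> _] := Xn_divmodS r_gt0 (f_monic x) (f_size x) k; rewrite coefD coefMX
      coefC addr0.
  suff step : attains (r * 2) m2 (fun m' => availp m' (fun x => 'X^(k.+1) %% f x)).
    by apply: attains_weaken step (leqnn _) _ => m3 s3 avM'; split; first exact:
      availp_sub avS.
  apply: attains_poly; first exact/s2/s1.
    by move=> x; apply: size_mod_monic.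
  move=> j m3 lt_j s3; rewrite -[2%N]/(1 + 1)%N.
  have av_shift : avail m3 (fun x => (('X^k %% f x) * 'X)`_j).
    case: j lt_j => [|j] _.
      by apply: eq_avail (s3 _ (s2 _ (s1 _ av0))) => x; rewrite coefMX.
    by apply: eq_avail (s3 _ (avM j)) => x; rewrite coefMX.
  apply: attains_bind (attains_mul (s3 _ (avM r.-1)) (s3 _ (s2 _ (s1 _ (avf j))))) _ =>
    m4 s4 avp.
  apply: attains_weaken (attains_sub (s4 _ av_shift) avp) (leqnn _) _ => m5 _.
  apply: eq_avail => x.
  by have [_ ->] := Xn_divmodS r_gt0 (f_monic x) (f_size x) k; rewrite coefB coefZ.
- nia.
- by move=> m2 _ [].
Qed.

Definition modmul_ready m := [/\ avail m (fun=> 0), availp m f & availp m barrett_poly].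

Lemma modmul_ready_sub m m' : sub_memory m m' -> modmul_ready m -> modmul_ready m'.
Proof.
by move=> sub [av0 avf avB]; split; [exact: sub|exact: availp_sub avf|exact: availp_sub
  avB].
Qed.

(** The three products are P Q, the one yielding the quotient, and the quotient times the truncated
    modulus; one subtraction per coefficient follows. *)
Lemma attains_modmul m P Q :
  modmul_ready m -> (forall x, size (P x) <= r)%N -> (forall x, size (Q x) <= r)%N ->
  availp m P -> availp m Q ->
  attains (3 * c + r) m (fun m' => availp m' (fun x => (P x * Q x) %% f x)).
Proof.
move=> [av0 avf avB] szP szQ avP avQ.
have -> : (3 * c + r = c + (c + (c + r * 1)))%N by lia.
apply: attains_bind (attains_polymul mulr r_gt0 szP szQ av0 avP avQ) _ => m1 s1 avPQ.
have szPQ x : (size (P x * Q x)%R <= (r + r).-1)%N.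
  by apply: leq_trans (size_polyMleq _ _) _; rewrite -!subn1 leq_sub2r // leq_add.
have szu x : (size (drop_poly r (P x * Q x)) <= r)%N.
  by rewrite size_drop_poly; have := szPQ x; lia.
apply: attains_bind (attains_polymul mulr r_gt0 szu _ (s1 _ av0) (availp_drop r avPQ)
  (availp_sub s1 avB)) _; first by move=> x; apply: size_Xn_div.
move=> m2 s2 avuB; have s02 := sub_memory_trans s1 s2.
have av_div : availp m2 (fun x => (P x * Q x) %/ f x).
  by apply: eq_availp (availp_drop r.-1 avuB) => x; rewrite (barrett_div r_gt0 (f_monic
    x) (f_size x) (szPQ x)).
apply: attains_bind (attains_polymul mulr r_gt0 _ _ (s02 _ av0) av_div
  (availp_take r (s02 _ av0) (availp_sub s02 avf))) _.
- by move=> x; rewrite size_divp ?monic_neq0 // f_size; apply: leq_trans (leq_sub2r _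
  (szPQ x)) _; lia.
- by move=> x; apply: size_take_poly.
move=> m3 s3 avqf; apply: attains_poly; first exact/s3/s02.
  by move=> x; apply: size_mod_monic.
move=> j m4 lt_j s4.
apply: attains_weaken (attains_sub (s4 _ (s3 _ (s2 _ (avPQ j)))) (s4 _ (avqf j)))
  (leqnn _) _.
move=> m5 _; apply: eq_avail => x.
by rewrite (barrett_mod (f_monic x) (f_size x) (szPQ x)) coef_take_poly lt_j coefB.
Qed.

(** Square and multiply. The case distinction is on the parity of the exponent, which is known when
    the program is written, and not on the data. *)
Lemma attains_modexp L n m P :
  (n < 2 ^ L)%N -> modmul_ready m -> (forall x, size (P x) <= r)%N -> availp m P ->
  attains (L * (2 * (3 * c + r))) m (fun m' => availp m' (fun x => P x ^+ n %% f x)).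
Proof.
elim: L n => [|L IH] n lt_n rdy szP avP.
  have -> : n = 0%N by case: n lt_n.
  rewrite mul0n; apply: attains_weaken (attains_const m 1) (leqnn _) _ => m1 s1 av1.
  have [av0 _ _] := modmul_ready_sub s1 rdy.
  apply: (eq_availp (P := fun=> 1%:P)) => [x|].
    by rewrite expr0 modp_small // size_polyC oner_eq0 f_size ltnS.
  move=> [|j]; first by apply: eq_avail av1 => x; rewrite coefC.
  by apply: eq_avail av0 => x; rewrite coefC.
have lt_n2 : (n./2 < 2 ^ L)%N by rewrite expnS in lt_n; lia.
have -> : (L.+1 * (2 * (3 * c + r)) =
  L * (2 * (3 * c + r)) + ((3 * c + r) + (3 * c + r)))%N by lia.
apply: attains_bind (IH _ lt_n2 rdy szP avP) _ => m1 s1 av1.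
have sz1 Q x : (size (Q x %% f x)%R <= r)%N by apply: size_mod_monic.
apply: attains_bind (attains_modmul (modmul_ready_sub s1 rdy) (sz1 _) (sz1 _) av1 av1) _.
move=> m2 s2 av2; have s02 := sub_memory_trans s1 s2.
have sq x : (P x ^+ n./2 %% f x * (P x ^+ n./2 %% f x)) %% f x = P x ^+ n./2.*2 %% f x.
  by rewrite modp_mul mulrC modp_mul -exprD addnn.
have := odd_double_half n; case: odd => /= nE; last first.
  rewrite add0n in nE; rewrite -[(3 * c + r)%N]add0n.
  apply: attains_weaken (attains_ret (Q := fun m' => availp m' (fun x => P x ^+ n %% f
    x)) _) _ (fun _ _ h => h) => //.
  by apply: eq_availp av2 => x; rewrite sq nE.
apply: attains_weaken (attains_modmul (modmul_ready_sub s02 rdy) szP (sz1 _)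
  (availp_sub s02 avP) av2) (leqnn _) _.
move=> m3 _; apply: eq_availp => x.
by rewrite sq modp_mul -exprS -add1n nE.
Qed.

Lemma attains_powers n m P :
  modmul_ready m -> (forall x, size (P x) <= r)%N -> availp m P ->
  attains (n * (3 * c + r)) m (fun m' =>
    forall j, (j < n)%N -> availp m' (fun x => P x ^+ j %% f x)).
Proof.
move=> rdy szP avP; rewrite -[(n * _)%N]add0n.
apply: attains_bind (attains_modexp (L := 0) (n := 0) _ rdy szP avP) _ => // m1 s1 av1.
apply: attains_weaken (attains_loop (n := n) (c := (3 * c + r)%N)
   (Q := fun k m' => forall j, (j <= k)%N -> availp m' (fun x => P x ^+ j %% f x)) _ _)
     (leqnn _) _.
- by move=> j; rewrite leqn0 => /eqP ->.
- move=> k m2 _ s2 avk; have s02 := sub_memory_trans s1 s2.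
  apply: attains_weaken (attains_modmul (modmul_ready_sub s02 rdy) szP _ (availp_sub
    s02 avP) (avk k _)) (leqnn _) _ => //.
    by move=> x; apply: size_mod_monic.
  move=> m3 s3 av3 j; rewrite leq_eqVlt => /predU1P[->|].
    by apply: eq_availp av3 => x; rewrite modp_mul -exprS.
  by rewrite ltnS => /avk; apply: availp_sub.
by move=> m2 _ av2 j /ltnW; apply: av2.
Qed.

End ModMonic.

End PolyPrograms.

(** * The four steps of the algorithm *)

Section FrobeniusAlgebra.

Variables (F : finFieldType) (A : comAlgType F).

Lemma pnat_card_algebra : [pchar A].-nat #|F|.
Proof.
have [p p_pr pcharFp] := finPcharP F.
have pcharAp : p \in [pchar A].
  rewrite inE p_pr /= -scaler_nat -[p%:R]/(p%:R : F).
  by rewrite (pcharf0 pcharFp) scale0r.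
have -> : #|F| = #|pPrimeCharType pcharFp| by [].
by rewrite card_pprimeChar pnatX pnatE // pcharAp.
Qed.

Lemma exprD_card (a b : A) : (a + b) ^+ #|F| = a ^+ #|F| + b ^+ #|F|.
Proof. exact: exprDn_pchar pnat_card_algebra. Qed.

Lemma exprZ_card c (a : A) : (c *: a) ^+ #|F| = c *: a ^+ #|F|.
Proof. by rewrite exprZn expf_card. Qed.

Lemma expr_sum_card n (c : 'I_n -> F) (a : 'I_n -> A) :
  (\sum_i c i *: a i) ^+ #|F| = \sum_i c i *: a i ^+ #|F|.
Proof.
apply: (big_rec2 (fun x y => x ^+ #|F| = y)) => [|i x y _ <-].
  by rewrite expr0n -leqn0 leqNgt ltnW // finNzRing_gt1.
by rewrite exprD_card exprZ_card.
Qed.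

End FrobeniusAlgebra.

Section FrobeniusModPoly.

Variables (F : finFieldType) (r : nat) (f : {poly F}).
Hypotheses (f_monic : f \is monic) (f_size : size f = r.+1).
Local Notation q := #|F|.

Lemma modp_sum n (P : 'I_n -> {poly F}) : (\sum_i P i) %% f = \sum_i (P i %% f).
Proof. by apply: (big_morph _ (modpD f)); rewrite mod0p. Qed.

Lemma modp_exp (P : {poly F}) n : (P %% f) ^+ n %% f = P ^+ n %% f.
Proof.
elim: n => // n IH.
by rewrite exprS -modp_mul IH modp_mul mulrC modp_mul mulrC -exprS.
Qed.

Lemma poly_sum_coef n (P : {poly F}) : (size P <= n)%N -> P = \sum_(i < n) P`_i *: 'X^i.
Proof.
by move=> sP; rewrite -poly_def; apply/polyP => i; rewrite coef_poly; case: ltnP => //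
  /(leq_trans sP)/leq_sizeP->.
Qed.

(** Since c^q = c for c in F, P^q = P(X^q). With the powers of X^q at hand, a q-th power becomes a
    linear combination and no factor log q is paid. *)
Lemma frob_mod n (P : {poly F}) : (size P <= n)%N ->
  \sum_(j < n) P`_j *: (('X^q %% f) ^+ j %% f) = P ^+ q %% f.
Proof.
move=> sP; rewrite {2}(poly_sum_coef sP) expr_sum_card modp_sum.
by apply: eq_bigr => j _; rewrite modpZl modp_exp -!exprM mulnC.
Qed.

End FrobeniusModPoly.

Section AllombertPrograms.

Variables (F : finFieldType) (I : Type) (f0 h : I -> {poly F}) (r s c : nat).
Hypotheses (r_gt1 : (1 < r)%N) (mulr : polymul_within F r c).
Hypotheses (f0_size : forall x, size (f0 x) = r.+1) (h_size : forall x, size (h x) = s.+1).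

Local Notation q := #|F|.
Local Notation f := (fun x => (lead_coef (f0 x))^-1 *: f0 x).

Let r_gt0 : (0 < r)%N := ltnW r_gt1.

Let lead_f0 x : lead_coef (f0 x) != 0.
Proof. by rewrite lead_coef_eq0 -size_poly_eq0 f0_size. Qed.

Let f_monic x : f x \is monic.
Proof. by rewrite monicE lead_coefZ mulVf. Qed.

Let f_size x : size (f x) = r.+1.
Proof. by rewrite size_scale ?invr_eq0. Qed.

Implicit Types (m : memory F I).

(** The residue representing the image of X^j under the k-th iterate of the Frobenius; for k = 1
    these are the columns of the matrix of sigma. *)
Definition conj_power k j x : {poly F} := ('X^(q ^ k) %% f x) ^+ j %% f x.

Lemma size_conj_power k j x : (size (conj_power k j x) <= r)%N.
Proof. exact: size_mod_monic. Qed.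

Definition sigma_ready m :=
  [/\ modmul_ready r f m, availp m h & forall j, (j < r)%N -> availp m (conj_power 1 j)].

Lemma sigma_ready_sub m m' : sub_memory m m' -> sigma_ready m -> sigma_ready m'.
Proof.
move=> sub [rdy avh avphi]; split; first exact: modmul_ready_sub rdy.
  exact: availp_sub avh.
by move=> j /avphi; apply: availp_sub.
Qed.

Lemma attains_sigma L m : (q < 2 ^ L)%N ->
  (forall j, (j < r.+1)%N -> avail m (fun x => (f0 x)`_j)) ->
  (forall j, (j < s.+1)%N -> avail m (fun x => (h x)`_j)) ->
  attains (r.+1 + r * r * 4 + L * (2 * (3 * c + r)) + r * (3 * c + r)) m sigma_ready.
Proof.
move=> lt_q avf0 avh.
have -> : (r.+1 + r * r * 4 + L * (2 * (3 * c + r)) + r * (3 * c + r) =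
  0 + (0 + (r.+1 * 1 + (r * r * 4 + (L * (2 * (3 * c + r)) + r * (3 * c + r))))))%N by lia.
apply: attains_bind (attains_const m 0) _ => m0 s0 av0.
apply: attains_bind (attains_const m0 1) _ => m1 s1 av1.
have s01 := sub_memory_trans s0 s1.
have avh1 : availp m1 h.
  move=> j; case: (ltnP j s.+1) => [/avh/s01 // | le_j].
  by apply: eq_avail (s1 _ av0) => x; rewrite nth_default ?h_size.
(* The input is made monic by dividing by its coefficient at position r, which is nonzero on every
   input. *)
apply: attains_bind (attains_poly (P := f) (n := r.+1) (c := 1) (s1 _ av0) _ _) _.
- by move=> x; rewrite f_size.
- move=> j m2 lt_j s2.
  apply: attains_weaken (attains_div (s2 _ (s01 _ (avf0 j lt_j))) (s2 _ (s01 _ (avf0 r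
    _))) _) (leqnn _) _ => //.
    by move=> x; have := lead_f0 x; rewrite lead_coefE f0_size.
  by move=> m3 _; apply: eq_avail => x; rewrite coefZ mulrC lead_coefE f0_size.
move=> m2 s2 avf; have s12 := sub_memory_trans s1 s2.
apply: attains_bind (attains_barrett r_gt0 f_monic f_size (s12 _ av0) avf) _ => m3 s3 avB.
have s13 := sub_memory_trans s12 s3.
have rdy : modmul_ready r f m3 by split; [exact/s13 | exact: availp_sub avf | exact: avB].
have avX : availp m3 (fun=> 'X).
  apply: (availp_const _ (s13 _ av0)) => i; rewrite size_polyX.
  case: i => [|[|i]] // _; rewrite coefX /=; [exact: s13 | exact/s3/s2].
apply: attains_bind (attains_modexp r_gt0 mulr f_monic f_size lt_q rdy _ avX) _.
  by move=> x; rewrite size_polyX.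
move=> m4 s4 avXq.
apply: attains_weaken (attains_powers r_gt0 mulr f_monic f_size r (modmul_ready_sub s4
  rdy) _ avXq) (leqnn _) _.
  by move=> x; apply: size_mod_monic.
move=> m5 s5 avpow; split; first exact: modmul_ready_sub (sub_memory_trans s4 s5) rdy.
  exact: availp_sub (sub_memory_trans s2 (sub_memory_trans s3 (sub_memory_trans s4
    s5))) avh1.
by move=> j lt_j; apply: eq_availp (avpow j lt_j) => x; rewrite /conj_power expn1.
Qed.

Lemma attains_frob m (P : I -> {poly F}) :
  sigma_ready m -> (forall x, size (P x) <= r)%N -> availp m P ->
  attains (r * (r * 2)) m (fun m' => availp m' (fun x => P x ^+ q %% f x)).
Proof.
move=> [[av0 _ _] _ avphi] szP avP.
apply: attains_weaken (attains_lincomb (n := r) (r := r) (c := fun j x => (P x)`_j)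
  (P := conj_power 1) av0 _ avphi _) (leqnn _) _ => //.
  by move=> j x _; apply: size_conj_power.
by move=> m1 _; apply: eq_availp => x; rewrite -(frob_mod _ (szP x)) /conj_power expn1.
Qed.

Definition hhat_column j x : {poly F} :=
  \sum_(k < s.+1) (h x)`_k *: conj_power k j x.

Lemma attains_hhat m : sigma_ready m ->
  attains (s.+1 * (r * (3 * c + r) + r * (r * 4))) m
    (fun m' => forall j, (j < r)%N -> availp m' (hhat_column j)).
Proof.
move=> rdy; have [[av0 _ _] avh _] := rdy.
rewrite -[(s.+1 * _)%N]add0n; apply: attains_bind (attains_const m 1) _ => m0 s0 av1.
(* The invariant keeps X^(q^k) and the k-th partial sums of all r columns. A round takes r modular
   products for the powers of X^(q^k), one Frobenius for the next conjugate, and O(r^2) to update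
   the sums. *)
pose Q k m' := availp m' (fun x => 'X^(q ^ k) %% f x) /\
  forall j, (j < r)%N -> availp m' (fun x => \sum_(i < k) (h x)`_i *: conj_power i j x).
apply: attains_weaken (attains_loop (n := s.+1) (Q := Q) _ _) (leqnn _) _; last by
  move=> m1 _ [].
  split=> [|j _ i]; last by apply: eq_avail (s0 _ av0) => x; rewrite big_ord0 coef0.
  (* X is its own residue because r > 1. *)
  apply: (@eq_availp _ _ _ (fun=> 'X)) => [x|].
    by rewrite expn0 expr1 modp_small // size_polyX f_size.
  apply: (availp_const _ (s0 _ av0)) => i; rewrite size_polyX.
  by case: i => [|[|i]] // _; rewrite coefX //=; exact: s0.
move=> k m1 lt_k s1 [avY avS].
have s01 := sub_memory_trans s0 s1.
have rdy1 := sigma_ready_sub s01 rdy.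
have -> : (r * (3 * c + r) + r * (r * 4) =
  r * (3 * c + r) + (r * (r * 2) + r * (r * 2)))%N by lia.
apply: attains_bind (attains_powers r_gt0 mulr f_monic f_size r _ _ avY) _.
- by case: rdy1.
- by move=> x; apply: size_mod_monic.
move=> m2 s2 avpow.
apply: attains_bind (attains_frob (sigma_ready_sub s2 rdy1) _ (availp_sub s2 avY)) _.
  by move=> x; apply: size_mod_monic.
move=> m3 s3 avY'.
apply: attains_weaken (attains_all (n := r) (c := (r * 2)%N) (Q := fun j m' =>
   availp m' (fun x => \sum_(i < k.+1) (h x)`_i *: conj_power i j x)) _ _) (leqnn _) _.
- by move=> j m4 m5 sub; apply: availp_sub.
- move=> j m4 lt_j s4; have s14 := sub_memory_trans s2 (sub_memory_trans s3 s4).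
  have s04 := sub_memory_trans s01 s14.
  apply: attains_poly; first exact: s04.
    move=> x; apply: leq_trans (size_sum _ _ _) _; apply/bigmax_leqP => i _.
    by apply: leq_trans (size_scale_leq _ _) _; apply: size_conj_power.
  move=> i m5 lt_i s5; rewrite -[2%N]/(1 + 1)%N.
  apply: attains_bind (attains_mul (s5 _ (s04 _ (avh k))) (s5 _ (s4 _ (s3 _ (avpow j
    lt_j i))))) _.
  move=> m6 s6 avp.
  apply: attains_weaken (attains_add (s6 _ (s5 _ (s14 _ (avS j lt_j i)))) avp) (leqnn _) _.
  by move=> m7 _; apply: eq_avail => x; rewrite big_ord_recr coefD coefZ.
move=> m4 s4 av4; split => //.
apply: eq_availp (availp_sub s4 avY') => x.
by rewrite modp_exp -exprM -expnSr.
Qed.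

Definition hhat_matrix x : 'M[F]_r := \matrix_(i, j) (hhat_column j x)`_i.

Definition poly_of_col (v : 'cV[F]_r) : {poly F} := rVpoly v^T.

Lemma attains_kernel_poly N cginv cmul m :
  (r <= N)%N -> matmul_within F N cmul -> ginv_within F I r r cginv ->
  (forall j, (j < r)%N -> availp m (hhat_column j)) -> avail m (fun=> 0) ->
  (forall x, exists2 v : 'cV_r, v != 0 & hhat_matrix x *m v = 0) ->
  attains (cginv + cmul + 5 * (r * r)) m (fun m' =>
    exists2 v : I -> 'cV_r, availp m' (fun x => poly_of_col (v x)) &
      forall x, v x != 0 /\ hhat_matrix x *m v x = 0).
Proof.
move=> rN mmN ginv avh av0 sing.
have [r' rE] : exists r', r = r'.+1 by exists r.-1; rewrite prednK.
suff: attains (cginv + cmul + 5 * (r * r)) m (fun m' =>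
    exists2 v : I -> 'cV_r, availmx m' v & forall x, v x != 0 /\ hhat_matrix x *m v x = 0).
  move=> att; apply: attains_weaken att (leqnn _) _ => m' sub [v avv vP].
  exists v => // j; case: (ltnP j r) => lt_j.
    apply: eq_avail (avv (Ordinal lt_j) 0) => x.
    by rewrite coef_rVpoly insubT /= mxE.
  apply: eq_avail (sub _ av0) => x; rewrite nth_default //.
  by rewrite (leq_trans (size_poly _ _)).
have avA : availmx m hhat_matrix.
  by move=> i j; apply: eq_avail (avh j (ltn_ord j) i) => x; rewrite mxE.
move: hhat_matrix avA sing ginv rN; rewrite rE => A avA sing ginv rN.
exact: attains_kernel rN mmN ginv avA sing.
Qed.

(** The recurrence for the b_i evaluated at the Frobenius and applied to a, in Horner style: each
    further coordinate of theta costs one Frobenius and one scaled addition. *)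
Fixpoint theta_coord (x : I) (a : {poly F}) n : {poly F} :=
  if n is n'.+1 then theta_coord x a n' ^+ q %% f x + (h x)`_(s.-1 - n') *: a else a.

Lemma size_theta_coord x (a : {poly F}) n : (size a <= r)%N -> (size (theta_coord x a
  n) <= r)%N.
Proof.
move=> sa; case: n => [|n] //=; apply: leq_trans (size_polyD _ _) _.
rewrite geq_max size_mod_monic //=.
exact: leq_trans (size_scale_leq _ _) sa.
Qed.

Lemma attains_theta m (a : I -> {poly F}) :
  sigma_ready m -> availp m a -> (forall x, size (a x) <= r)%N ->
  attains (s * (r * (r * 2) + r * 2)) m (fun m' =>
    forall n, (n <= s)%N -> availp m' (fun x => theta_coord x (a x) n)).
Proof.
move=> rdy ava sza.
apply: (@attains_loop _ _ s _ _ (fun k m' => forall n, (n <= k)%N ->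
  availp m' (fun x => theta_coord x (a x) n))).
  by move=> n; rewrite leqn0 => /eqP ->.
move=> k m1 _ s1 avk; have rdy1 := sigma_ready_sub s1 rdy.
apply: attains_bind (attains_frob rdy1 _ (avk k (leqnn _))) _.
  by move=> x; apply: size_theta_coord.
move=> m2 s2 avfr; have [[av0 _ _] avh _] := sigma_ready_sub s2 rdy1.
apply: attains_weaken (attains_poly (P := fun x => theta_coord x (a x) k.+1) (n := r)
  (c := 2) av0 _ _) (leqnn _) _.
- by move=> x; apply: size_theta_coord.
- move=> j m3 lt_j s3; rewrite -[2%N]/(1 + 1)%N.
  apply: attains_bind (attains_mul (s3 _ (avh (s.-1 - k)%N)) (s3 _ (s2 _ (s1 _ (ava
    j))))) _ => m4 s4 avp.
  apply: attains_weaken (attains_add (s4 _ (s3 _ (avfr j))) avp) (leqnn _) _ => m5 _.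
  by apply: eq_avail => x; rewrite /= coefD coefZ.
move=> m3 s3 av3 n; rewrite leq_eqVlt => /predU1P[-> //|].
rewrite ltnS => /avk; apply: availp_sub; exact: sub_memory_trans s3.
Qed.

End AllombertPrograms.

(** * The Frobenius map on k *)

Section FrobeniusOnK.

Variables (F : finFieldType) (f0 : {poly F}) (r : nat).
Hypotheses (f0_irr : irreducible_poly f0) (f0_size : size f0 = r.+1).

Local Notation q := #|F|.
Local Notation f := ((lead_coef f0)^-1 *: f0).
Local Notation k := (kfield f0).
Local Notation frobk := (@frob F f0).
Local Notation hatk := (@hat_k F f0).

Lemma lead_f0_neq0 : lead_coef f0 != 0.
Proof. by rewrite lead_coef_eq0 -size_poly_eq0 f0_size. Qed.

Lemma monic_normalize : f \is monic.
Proof. by rewrite monicE lead_coefZ mulVf // lead_f0_neq0. Qed.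

Lemma size_normalize : size f = r.+1.
Proof. by rewrite size_scale ?invr_eq0 ?lead_f0_neq0. Qed.

Lemma normalize_irreducible : monic_irreducible_poly f.
Proof.
split; last exact: monic_normalize.
case: f0_irr => sz irr; split; first by rewrite size_normalize -f0_size.
move=> p sp; have eqpf : f0 %= f by rewrite eqp_sym eqp_scale ?invr_eq0 ?lead_f0_neq0.
by rewrite -(eqp_dvdr _ eqpf) => /(irr p sp) pf; apply: eqp_trans pf eqpf.
Qed.

Lemma mk_monic_normalize : mk_monic f = f.
Proof. exact: mk_monicE normalize_irreducible. Qed.

Lemma val_in_k (p : {poly F}) : in_qpoly f p = p %% f :> {poly F}.
Proof. by rewrite /= mk_monic_normalize Pdiv.IdomainMonic.modpE ?monic_normalize. Qed.

Lemma val_in_k_small (p : {poly F}) : (size p <= r)%N -> in_qpoly f p = p :> {poly F}.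
Proof. by move=> sp; rewrite in_qpoly_small // mk_monic_normalize size_normalize. Qed.

Lemma size_k (a : k) : (size (a : {poly F}) <= r)%N.
Proof.
have sz : size (mk_monic f) = r.+1 by rewrite mk_monic_normalize size_normalize.
by rewrite -ltnS -sz; apply: size_mk_monic.
Qed.

Lemma val_expk (a : k) n : a ^+ n = (a : {poly F}) ^+ n %% f :> {poly F}.
Proof.
rewrite poly_of_qpolyX; move: (polyn a) => p.
by rewrite mk_monic_normalize Pdiv.IdomainMonic.modpE ?monic_normalize.
Qed.

Lemma iter_frob n (a : k) : iter n frobk a = a ^+ (q ^ n).
Proof. by elim: n => [|n IH] /=; rewrite ?expn0 ?expr1 // IH /frob -exprM -expnSr. Qed.

Lemma frob0 : frobk 0 = 0.
Proof. by rewrite /frob expr0n -leqn0 leqNgt ltnW // finNzRing_gt1. Qed.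

Lemma frob_sum n (c : 'I_n -> F) (a : 'I_n -> k) :
  frobk (\sum_i c i *: a i) = \sum_i c i *: frobk (a i).
Proof. exact: expr_sum_card. Qed.

Lemma iter_frob_linear n m (c : 'I_m -> F) (a : 'I_m -> k) :
  iter n frobk (\sum_i c i *: a i) = \sum_i c i *: iter n frobk (a i).
Proof. by elim: n => //= n ->; rewrite frob_sum. Qed.

Lemma hat_kE n (A : {poly F}) (a : k) : (size A <= n)%N ->
  hatk A a = \sum_(j < n) A`_j *: iter j frobk a.
Proof.
move=> sA; rewrite /hat_k (big_ord_widen _ (fun j => A`_j *: iter j frobk a) sA).
rewrite big_mkcond; apply: eq_bigr => j _; case: ltnP => // le_j.
by rewrite nth_default // scale0r.
Qed.

Lemma hat_k_linear A m (c : 'I_m -> F) (a : 'I_m -> k) :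
  hatk A (\sum_i c i *: a i) = \sum_i c i *: hatk A (a i).
Proof.
rewrite /hat_k; under eq_bigr => j _ do rewrite iter_frob_linear scaler_sumr.
rewrite exchange_big; apply: eq_bigr => i _; rewrite scaler_sumr.
by apply: eq_bigr => j _; rewrite !scalerA mulrC.
Qed.

Lemma hat_k0 (a : k) : hatk 0 a = 0.
Proof. by rewrite /hat_k size_poly0 big_ord0. Qed.

Lemma hat_kD A B a : hatk (A + B) a = hatk A a + hatk B a.
Proof.
pose n := maxn (size A) (size B).
rewrite !(@hat_kE n) ?leq_maxl ?leq_maxr ?size_polyD // -big_split.
by apply: eq_bigr => j _; rewrite coefD scalerDl.
Qed.

Lemma hat_kZ c A a : hatk (c *: A) a = c *: hatk A a.
Proof.
rewrite !(@hat_kE (size A)) ?size_scale_leq // scaler_sumr.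
by apply: eq_bigr => j _; rewrite coefZ scalerA.
Qed.

Lemma hat_kMX A a : hatk (A * 'X) a = frobk (hatk A a).
Proof.
rewrite !(@hat_kE (size A).+1) ?leqnSn //; last first.
  by rewrite (leq_trans (size_polyMleq _ _)) // size_polyX addn2.
rewrite big_ord_recl coefMX scale0r add0r big_ord_recr /=.
rewrite [A`_(size A)]nth_default // scale0r addr0 frob_sum.
by apply: eq_bigr => j _; rewrite coefMX.
Qed.

Lemma hat_kC c a : hatk c%:P a = c *: a.
Proof. by rewrite (@hat_kE 1) ?size_polyC_leq1 // big_ord1 coefC. Qed.

(** Coefficients in F commute with the Frobenius, so substituting it is a ring morphism from F[S] to
    the endomorphisms of k. *)
Lemma hat_kM A B a : hatk (A * B) a = hatk A (hatk B a).
Proof.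
elim/poly_ind: A => [|A c IH]; first by rewrite mul0r !hat_k0.
rewrite mulrDl mulrAC !hat_kD !hat_kMX IH; congr (_ + _).
by rewrite hat_kC mul_polyC hat_kZ.
Qed.

Lemma hat_kXn n a : hatk 'X^n a = a ^+ (q ^ n).
Proof. by rewrite -iter_frob; elim: n => [|n IH] /=; rewrite ?hat_kC ?scale1r // exprSr
  hat_kMX IH. Qed.

Lemma expk_card (a : k) : a ^+ (q ^ r) = a.
Proof.
have := @expf_card {poly %/ f with normalize_irreducible} a.
by rewrite card_qfpoly size_normalize.
Qed.

Lemma hat_k_Xr_sub1 a : hatk ('X^r - 1) a = 0.
Proof.
by rewrite hat_kD hat_kXn expk_card -scaleN1r hat_kZ hat_kC scale1r scaleN1r subrr.
Qed.

Lemma hat_k_neq0 (A : {poly F}) : A != 0 -> (size A <= r)%N -> exists a : k, hatk A a != 0.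
Proof.
move=> nzA sA.
have r_gt0 : (0 < r)%N by case: f0_irr; rewrite f0_size.
have q_gt0 : (0 < q)%N by rewrite ltnW // finNzRing_gt1.
pose K := {poly %/ f with normalize_irreducible}.
pose G : {poly K} := \sum_(j < size A) (A`_j *: (1 : K)) *: 'X^(q ^ j).
have horG (a : K) : G.[a] = hatk A a.
  rewrite horner_sum; apply: eq_bigr => j _.
  by rewrite hornerZ hornerXn iter_frob -scalerAl mul1r.
have sG : (size G <= (q ^ r.-1).+1)%N.
  apply: leq_trans (size_sum _ _ _) _; apply/bigmax_leqP => j _.
  apply: leq_trans (size_scale_leq _ _) _; rewrite size_polyXn ltnS leq_pexp2l //.
  by have := ltn_ord j; lia.
have nzG : G != 0.
  (* The exponents q^j are distinct, so this coefficient is the leading coefficient of A. *)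
  apply/eqP => /(congr1 (fun P : {poly K} => P`_(q ^ (size A).-1))); rewrite coef0 coef_sum.
  have sz_gt0 : (0 < size A)%N by rewrite size_poly_gt0.
  have lt_last : ((size A).-1 < size A)%N by rewrite prednK.
  rewrite (bigD1 (Ordinal lt_last)) //=.
  rewrite coefZ coefXn eqxx mulr1 big1 ?addr0 => [/eqP|j jn].
    by rewrite scaler_eq0 oner_eq0 orbF -lead_coefE lead_coef_eq0 (negPf nzA).
  rewrite coefZ coefXn eqn_exp2l ?finNzRing_gt1 // [_ == _]eq_sym.
  by rewrite (_ : (_ == _) = false) ?mulr0 //; apply: negPf.
have [a nza|all0] := pickP (fun a : K => G.[a] != 0).
  by exists a; rewrite -horG.
have all_roots : all (root G) (enum K).
  by apply/allP => a _; rewrite rootE -[_ == _]negbK all0.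
have := max_poly_roots nzG all_roots (enum_uniq _).
rewrite -cardE card_qfpoly size_normalize /= ltnNge => /negP[].
apply: leq_trans sG _; rewrite -{2}(prednK r_gt0) expnS.
by apply: ltn_Pmull; rewrite ?finNzRing_gt1 // expn_gt0 q_gt0.
Qed.

(** With g the cofactor of h in X^r - 1, every value of g(Frob) is killed by h(Frob), because Frob^r
    = 1 on k; some value is nonzero, because g has degree less than r. *)
Lemma hat_k_singular (h : {poly F}) : (1 < size h)%N -> h %| 'X^r - 1 ->
  exists2 a : k, a != 0 & hatk h a = 0.
Proof.
move=> sh hX; have /divpK gh := hX; set g := _ %/ h in gh.
have r_gt0 : (0 < r)%N by case: f0_irr; rewrite f0_size.
have nzX : 'X^r - 1 != 0 :> {poly F} by rewrite -size_poly_eq0 size_XnsubC.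
have nzg : g != 0 by apply: contraNneq nzX => g0; rewrite -gh g0 mul0r.
have sg : (size g <= r)%N.
  rewrite size_divp; last by rewrite -size_poly_gt0 ltnW.
  by rewrite size_XnsubC //; move: (size h) sh => n; lia.
have [a nza] := hat_k_neq0 nzg sg.
by exists (hatk g a) => //; rewrite -hat_kM mulrC gh hat_k_Xr_sub1.
Qed.

Lemma iter_frob_Xn n j : (j < r)%N ->
  iter n frobk (in_qpoly f 'X^j) = ('X^(q ^ n) %% f) ^+ j %% f :> {poly F}.
Proof.
move=> lt_j; rewrite iter_frob val_expk val_in_k_small ?size_polyXn //.
by rewrite modp_exp -!exprM mulnC.
Qed.

Lemma hat_k_Xn (h : {poly F}) n j : (j < r)%N -> (size h <= n)%N ->
  hatk h (in_qpoly f 'X^j) = \sum_(i < n) h`_i *: (('X^(q ^ i) %% f) ^+ j %% f) :> {poly F}.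
Proof.
move=> lt_j sh; rewrite (hat_kE _ sh) poly_of_qpoly_sum; apply: eq_bigr => i _.
by rewrite -iter_frob_Xn.
Qed.

Lemma k_sum_Xn (a : k) : a = \sum_(j < r) (a : {poly F})`_j *: in_qpoly f 'X^j.
Proof.
apply: val_inj; rewrite [RHS]poly_of_qpoly_sum [LHS](poly_sum_coef (size_k a)).
by apply: eq_bigr => j _; congr (_ *: _); apply: esym; apply: val_in_k_small; rewrite
  size_polyXn.
Qed.

Variables (h : {poly F}) (s : nat).
Hypotheses (h_monic : h \is monic) (s_gt0 : (0 < s)%N) (h_size : size h = s.+1).

Local Notation hk := (map_poly (@scalar_k F f0) h).

Lemma hk_monic : hk \is monic.
Proof. exact: (monic_map (@qpolyC F f)). Qed.

Lemma size_hk : size hk = size h.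
Proof. exact: (size_map_poly (@qpolyC F f)). Qed.

Lemma mk_monic_hk : mk_monic hk = hk.
Proof. by rewrite /mk_monic size_hk h_size ltnS s_gt0 hk_monic. Qed.

Lemma b_descS n :
  b_desc h n.+1 = b_desc h n * 'X + (h`_(s.-1 - n))%:P.
Proof. by rewrite /= h_size. Qed.

(** The recurrence collects the top n+1 coefficients of h, starting from the leading 1. Run one step
    past b_0, it returns h itself. *)
Lemma b_descE n : (n <= s)%N -> b_desc h n = drop_poly (s - n) h.
Proof.
elim: n => [_|n IH lt_n].
  apply/polyP => i; rewrite /= subn0 coef_drop_poly coefC.
  case: i => [|i] /=; last by rewrite nth_default // h_size; lia.
  by rewrite add0n -(monicP h_monic) lead_coefE h_size.
rewrite b_descS (IH (ltnW lt_n)); apply/polyP => i.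
rewrite coefD coefMX coefC !coef_drop_poly.
by case: i => [|i]; rewrite ?add0r ?addr0 /=; congr (h`_ _); lia.
Qed.

Lemma b_desc_size : b_desc h s = h.
Proof. by rewrite b_descE // subnn drop_poly0l. Qed.

Definition theta_poly (x : k) : {poly k} := \poly_(i < s) hatk (b_desc h (s.-1 - i)) x.

Lemma coef_theta_poly x i :
  (theta_poly x)`_i = if (i < s)%N then hatk (b_desc h (s.-1 - i)) x else 0.
Proof. exact: coef_poly. Qed.

Lemma scalar_k0 : @scalar_k F f0 0 = 0.
Proof. exact: qpolyC0. Qed.

(** The equation sigma(theta) = zeta theta lifted to k[Z], with x h(Z) as the multiple of h(Z) to be
    discarded. Coefficientwise it is the recurrence Frob(theta_i) = theta_(i-1) - h_i x. *)
Lemma map_frob_theta (x : k) : hatk h x = 0 ->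
  map_poly frobk (theta_poly x) = theta_poly x * 'X - x%:P * hk.
Proof.
move=> hx; apply/polyP => i; rewrite coef_map_id0; last exact: frob0.
rewrite coefB coefMX coefCM (coef_map_id0 _ _ scalar_k0) !coef_theta_poly.
have step n : frobk (hatk (b_desc h n) x) =
    hatk (b_desc h n.+1) x - h`_(s.-1 - n) *: x.
  by rewrite b_descS hat_kD hat_kMX hat_kC addrK.
have xh c : x * @scalar_k F f0 c = c *: x.
  apply: val_inj; rewrite /= mulrC mul_polyC; have := size_k x; move: (polyn x) => p sp.
  rewrite mk_monic_normalize Pdiv.CommonRing.rmodp_small // size_normalize ltnS.
  exact: leq_trans (size_scale_leq _ _) sp.
(* From degree s on only i = s matters: there theta_(s-1) = x cancels against the leading term of x
   h. *)
rewrite xh; case: (ltnP i s) => lt_i; last first.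
  rewrite frob0; case: i lt_i => [|i] lt_i; first by lia.
  rewrite /=; case: (ltnP i s) => lt_i'; last first.
    by rewrite [h`_ _]nth_default ?scale0r ?subr0 // h_size; lia.
  have -> : i.+1 = s by lia.
  have -> : (s.-1 - i = 0)%N by lia.
  have -> : h`_s = 1 by rewrite -(monicP h_monic) lead_coefE h_size.
  by rewrite hat_kC !scale1r subrr.
rewrite step; have -> : (s.-1 - (s.-1 - i) = i)%N by lia.
(* At i = 0 the recurrence has run past b_0 to h(Frob)(x), which is zero by the choice of x. *)
congr (_ - _); case: i lt_i => [|i] lt_i.
  have -> : (s.-1 - 0).+1 = s by lia.
  by rewrite b_desc_size hx.
rewrite [in RHS]/= ifT; last by lia.
by have -> : (s.-1 - i.+1).+1 = (s.-1 - i)%N by lia.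
Qed.

End FrobeniusOnK.

(** * The ring k[zeta] *)

Section ThetaInKzeta.

Variables (F : finFieldType) (f0 : {poly F}) (r : nat).
Hypotheses (f0_irr : irreducible_poly f0) (f0_size : size f0 = r.+1).
Variables (h : {poly F}) (s : nat).
Hypotheses (h_monic : h \is monic) (s_gt0 : (0 < s)%N) (h_size : size h = s.+1).

Local Notation q := #|F|.
Local Notation k := (kfield f0).
Local Notation frobk := (@frob F f0).
Local Notation hatk := (@hat_k F f0).
Local Notation hk := (map_poly (@scalar_k F f0) h).
Local Notation kz := (kzeta f0 h).
Local Notation theta x := (in_qpoly hk (theta_poly h s x) : kz).

Lemma mk_monic_h : mk_monic h = h.
Proof. by rewrite /mk_monic h_size ltnS s_gt0 h_monic. Qed.

Lemma val_theta (x : k) : theta x = theta_poly h s x :> {poly k}.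
Proof.
apply: in_qpoly_small; rewrite (mk_monic_hk _ h_monic s_gt0 h_size) size_hk h_size ltnS.
exact: size_poly.
Qed.

(** The coordinate on zeta^(s-1) is x itself, since b_(s-1) = 1. *)
Lemma theta_neq0 (x : k) : x != 0 -> theta x != 0.
Proof.
apply: contra => /eqP/(congr1 (fun u : kz => (u : {poly k})`_s.-1)).
rewrite val_theta coef_theta_poly prednK // leqnn subnn hat_kC scale1r => ->.
by rewrite coef0.
Qed.

Lemma sigma_theta (x : k) : hatk h x = 0 -> sigma (theta x) = zeta * theta x.
Proof.
move=> hx; rewrite {1}/sigma val_theta (map_frob_theta f0_irr f0_size h_monic s_gt0
  h_size hx).
rewrite rmorphB !rmorphM /= [X in _ - _ * X](_ : _ = 0) ?mulr0 ?subr0 1?mulrC //.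
apply: val_inj; rewrite /= (mk_monic_hk _ h_monic s_gt0 h_size).
by rewrite Pdiv.RingMonic.rmodpp // hk_monic.
Qed.

Lemma sigma_k_to_kzeta (a : k) : sigma (k_to_kzeta h a) = k_to_kzeta h (frobk a).
Proof.
rewrite /sigma; have -> : map_poly frobk (k_to_kzeta h a : {poly k}) = (frobk a)%:P.
  apply/polyP => i; rewrite coef_map_id0; last exact: frob0.
  by rewrite !coefC; case: eqP => // _; apply: frob0.
apply: val_inj => /=; rewrite Pdiv.CommonRing.rmodp_small //.
rewrite (mk_monic_hk _ h_monic s_gt0 h_size) size_hk h_size.
by rewrite (leq_ltn_trans (size_polyC_leq1 _)).
Qed.

Lemma iter_sigma n (a : k) :
  iter n sigma (k_to_kzeta h a) = k_to_kzeta h (iter n frobk a).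
Proof. by elim: n => //= n ->; apply: sigma_k_to_kzeta. Qed.

Lemma val_bpoly_coef j i :
  ((bpoly h)`_j : {poly F})`_i = if (i < s)%N then (b_desc h (s.-1 - i))`_j else 0.
Proof.
have qXn (n : 'I_s) : ('qX : Fzeta h) ^+ n = 'X^n :> {poly F}.
  rewrite -rmorphXn; apply: in_qpoly_small.
  by rewrite size_polyXn mk_monic_h h_size ltnS.
rewrite /bpoly coef_sum h_size /= poly_of_qpoly_sum coef_sum.
transitivity (\sum_(n < s) if i == n :> nat then (b_desc h (s.-1 - n))`_j else 0).
  apply: eq_bigr => n _; rewrite coefMC coef_map_id0; last exact: qpolyC0.
  have -> c : qpolyC h c = c%:A by apply: val_inj; rewrite /= alg_polyC.
  rewrite mulr_algl poly_of_qpolyZ qXn coefZ coefXn /b_ h_size.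
  by case: eqP; rewrite ?mulr1 ?mulr0.
case: (ltnP i s) => [lt_i|le_i]; last first.
  by rewrite big1 // => n _; rewrite gtn_eqF // (leq_trans (ltn_ord n)).
rewrite (bigD1 (Ordinal lt_i)) //= eqxx big1 ?addr0 // => n ne.
by rewrite ifF //; apply: contraNF ne => /eqP e; apply/eqP/val_inj.
Qed.

Lemma scalar_k_mul c (a : k) : @scalar_k F f0 c * a = c *: a.
Proof.
rewrite -[@scalar_k F f0 c]/(qpolyC _ c).
have -> : qpolyC ((lead_coef f0)^-1 *: f0) c = c%:A by apply: val_inj; rewrite /= alg_polyC.
exact: mulr_algl.
Qed.

Lemma k_to_kzetaE (a : k) : k_to_kzeta h a = in_qpoly hk a%:P.
Proof.
apply/esym/val_inj/in_qpoly_small.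
rewrite (mk_monic_hk _ h_monic s_gt0 h_size) size_hk h_size.
by rewrite (leq_ltn_trans (size_polyC_leq1 _)).
Qed.

(** On k the map sigma is the Frobenius, so collecting powers of zeta leaves b_i(Frob)(x) in front
    of zeta^i; this is why arithmetic in k suffices. *)
Lemma hat_bpoly (x : k) : hat (bpoly h) (k_to_kzeta h x) = theta x.
Proof.
have sb n : (n < s)%N -> (size (b_desc h (s.-1 - n)) <= size (bpoly h))%N.
  move=> lt_n; apply/leq_sizeP => j le_j.
  have := val_bpoly_coef j n; rewrite lt_n => <-.
  by rewrite [(bpoly h)`_j]nth_default // coef0.
rewrite /hat /Fzeta_to_kzeta.
under eq_bigr => j _ do rewrite iter_sigma k_to_kzetaE -rmorphM.
rewrite -rmorph_sum; congr (in_qpoly _ _); apply/polyP => i.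
rewrite coef_sum coef_theta_poly.
under eq_bigr => j _.
  rewrite coefMC coef_map_id0; last exact: qpolyC0.
  rewrite val_bpoly_coef scalar_k_mul.
  over.
case: (ltnP i s) => [lt_i|_]; last by rewrite big1 // => j _; rewrite scale0r.
by rewrite (hat_kE _ (sb i lt_i)).
Qed.

End ThetaInKzeta.

(** * Degree of the factors of the cyclotomic polynomial *)

(** The divisors of l^(e+1) are itself and those of l^e, so this polynomial is (X^(l^(e+1)) - 1) /
    (X^(l^e) - 1), a geometric sum. *)
Lemma Cyclotomic_prime_power l e : prime l ->
  'Phi_(l ^ e.+1) = \sum_(i < l) ('X^(l ^ e)) ^+ i :> {poly int}.
Proof.
move=> l_pr; have l_gt0 n : (0 < l ^ n)%N by rewrite expn_gt0 prime_gt0.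
have divE : perm_eq (divisors (l ^ e.+1)) ((l ^ e.+1)%N :: divisors (l ^ e)).
  apply: uniq_perm; first exact: divisors_uniq.
    rewrite /= divisors_uniq andbT -dvdn_divisors //.
    by rewrite dvdn_Pexp2l ?prime_gt1 // ltnn.
  move=> d; rewrite inE -!dvdn_divisors //; apply/idP/predU1P.
    case/(dvdn_pfactor _ _ l_pr) => m; rewrite leq_eqVlt => /predU1P[-> -> | lt_m ->];
      first by left.
    by right; rewrite dvdn_exp2l.
  by case=> [-> // | dv]; apply: dvdn_trans dv _; rewrite dvdn_exp2l.
have nz : 'X^(l ^ e) - 1 != 0 :> {poly int} by rewrite -size_poly_eq0 size_XnsubC.
apply: (mulIf nz); have := prod_Cyclotomic (l_gt0 e.+1).
rewrite (perm_big _ divE) big_cons prod_Cyclotomic // => ->.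
by rewrite mulrC -subrX1 -exprM expnSr.
Qed.

Section CyclotomicFactor.

Variables (F : finFieldType) (p l e : nat) (h : {poly F}).
Hypotheses (pcharFp : p \in [pchar F]) (l_pr : prime l).
Local Notation r := (l ^ e.+1)%N.
Hypotheses (p_ndvd : ~~ (p %| r)%N).
Hypotheses (h_irr : irreducible_poly h) (h_Phi : h %| map_poly intr 'Phi_r).

Local Notation q := #|F|.

Lemma factor_dvd_sum : h %| \sum_(i < l) ('X^(l ^ e)) ^+ i.
Proof.
have := h_Phi; rewrite Cyclotomic_prime_power // rmorph_sum /=.
by under eq_bigr => i _ do rewrite rmorphXn /= map_polyXn.
Qed.

Lemma factor_dvd_Xn_sub1 : h %| 'X^r - 1.
Proof. by rewrite expnSr exprM subrX1 dvdp_mull // factor_dvd_sum. Qed.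

Local Notation d := (size h).-1.
Local Notation f := ((lead_coef h)^-1 *: h).
Local Notation k := (kfield h).
Local Notation z := (in_qpoly f 'X : k).

Let h_size : size h = d.+1.
Proof. by rewrite prednK //; case: h_irr => /ltnW. Qed.

Lemma in_k_eq0 (P : {poly F}) : h %| P -> in_qpoly f P = 0 :> k.
Proof.
move=> hP; apply: val_inj; transitivity (P %% f); first exact: val_in_k h_irr h_size P.
apply: modp_eq0; apply: dvdp_trans hP.
by rewrite dvdpZl ?dvdpp // invr_eq0 (lead_f0_neq0 h_size).
Qed.

(** Here k is F[X]/h and z its root of h. An order other than r would divide l^e; the geometric sum
    killed by h would then evaluate to l, forcing l = 0 although p does not divide r. *)
Lemma root_primitive : r.-primitive_root z.
Proof.
have r_gt0 : (0 < r)%N by rewrite expn_gt0 prime_gt0.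
have zr1 : z ^+ r = 1.
  have := in_k_eq0 factor_dvd_Xn_sub1.
  by rewrite rmorphB rmorphXn rmorph1 => /eqP; rewrite subr_eq0 => /eqP.
have [m m_prim] := prim_order_exists r_gt0 zr1.
case/(dvdn_pfactor _ _ l_pr) => i; rewrite leq_eqVlt => /predU1P[-> mE|lt_i mE].
  by rewrite -mE.
have zm1 : z ^+ (l ^ e) = 1.
  by apply/eqP; rewrite -(prim_order_dvd m_prim) mE dvdn_exp2l.
have := in_k_eq0 factor_dvd_sum; rewrite rmorph_sum.
under eq_bigr => j _ do rewrite !rmorphXn zm1 expr1n.
rewrite sumr_const card_ord => l0.
have pcharKp : p \in [pchar k] by rewrite pchar_qpoly.
have := dvdn_pcharf pcharKp l; rewrite l0 eqxx => pl.
by case/negP: p_ndvd; rewrite (dvdn_trans pl) // dvdn_exp.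
Qed.

(** As z is primitive, the order of q divides n exactly when z^(q^n) = z. Thus it divides the degree
    d of h; were it smaller, Frob^s - 1 would vanish on all powers of z, hence on F[X]/h, against
    the independence of the first d powers of the Frobenius. *)
Lemma size_cyclotomic_factor (u : {unit 'Z_r}) :
  FinRing.uval u = q%:R -> size h = #[u]%g.+1.
Proof.
move=> uq; rewrite h_size; congr _.+1.
have r_gt1 : (1 < r)%N by rewrite (leq_trans (prime_gt1 l_pr)) // expnS leq_pmulr //
  expn_gt0 prime_gt0.
have ordE n : (#[u]%g %| n)%N = (z ^+ (q ^ n) == z).
  have := eq_prim_root_expr root_primitive (q ^ n) 1; rewrite expr1 => ->.
  rewrite order_dvdn -val_eqE /=.
  rewrite FinRing.val_unitX [\val u]uq -natrX -[1 in LHS]/(1%:R : 'Z_r).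
  by rewrite -[LHS]val_eqE /= val_Zp_nat // Zp_cast.
have s_dvd_d : (#[u]%g %| d)%N by rewrite ordE (expk_card h_irr h_size).
have d_gt0 : (0 < d)%N by rewrite -ltnS -h_size; case: h_irr.
apply/eqP; rewrite eqn_leq (dvdn_leq d_gt0 s_dvd_d) andbT leqNgt; apply/negP => lt_sd.
have s_gt0 : (0 < #[u]%g)%N by rewrite order_gt0.
have nz : 'X^(#[u]%g) - 1 != 0 :> {poly F} by rewrite -size_poly_eq0 size_XnsubC.
have sz : (size ('X^(#[u]%g) - 1 : {poly F})%R <= d)%N by rewrite size_XnsubC.
have [a] := hat_k_neq0 h_irr h_size nz sz; case/eqP.
rewrite (k_sum_Xn h_irr h_size a) hat_k_linear big1 // => j _.
rewrite hat_kD hat_kXn -scaleN1r hat_kZ hat_kC scale1r scaleN1r rmorphXn.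
have /eqP zs : z ^+ (q ^ #[u]%g) == z by rewrite -ordE.
by rewrite -exprM mulnC exprM zs subrr scaler0.
Qed.

End CyclotomicFactor.

(** * Cost estimates *)

Lemma run_cost0 (F : fieldType) (code : seq (instr F)) :
  cost code = 0%N -> exists cs, forall mem, run code mem = Some (mem ++ cs).
Proof.
elim: code => [_|[a|i j|i j|i j|i j|i] code IH] //=; first by exists [::] => mem;
  rewrite cats0.
by move=> /IH[cs runE]; exists (a :: cs) => mem; rewrite runE -cats1 -catA.
Qed.

Lemma polymul_cost1 (R : realType) (F : fieldType) (M : nat -> R) :
  polymul_cost F M -> 1 <= M 1%N.
Proof.
case/(_ 1%N isT) => code [out [leM run_code]].
apply: le_trans leM; rewrite ler1n lt0n; apply/eqP => /run_cost0[cs runE].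
have val (a b : F) : (a :: b :: cs)`_(nth 0%N out 0) = a * b.
  have sz c : (size (c%:P : {poly F}) <= 1)%N by apply: size_polyC_leq1.
  have [mem] := run_code a%:P b%:P (sz a) (sz b).
  rewrite runE => -[<-]; rewrite /coefs /= !coefC /=.
  by case: out {run_code} => //= i out [-> _]; rewrite -polyCM coefC.
(* The result would have to be a, or b, or a value that is the same for all inputs; none of these is
   always a b. *)
move: (nth _ _ _) val => [|[|i]] /= val.
- by have := val 1 0; rewrite mulr0 => /eqP; rewrite oner_eq0.
- by have := val 0 1; rewrite mul0r => /eqP; rewrite oner_eq0.
- by have := val 1 1; rewrite (val 0 0) mulr0 mulr1 => /esym/eqP; rewrite oner_eq0.
Qed.

(** This allows the linear work around a product to be charged to M. *)
Lemma polymul_cost_ge (R : realType) (F : fieldType) (M : nat -> R) n :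
  polymul_cost F M -> superlinear M -> (0 < n)%N -> n%:R <= M n.
Proof.
move=> mulM [superM _] n_gt0; have := superM 1%N n isT n_gt0.
rewrite divr1 ler_pdivlMr ?ltr0n // => le_n; apply: le_trans le_n.
by rewrite ler_peMl ?ler0n // (polymul_cost1 mulM).
Qed.

(** * Solving the recurrence for the cost of a generalized inverse *)

Section MatrixCost.

Variables (R : realType) (omega c : R) (cmul : nat -> nat).
Hypotheses (omega_gt2 : 2 < omega) (c_ge0 : 0 <= c).

Local Notation W t := ((2 ^ t)%N%:R `^ omega : R).
Local Notation B := (2 `^ omega : R).

Hypothesis cmul_le : forall t, (cmul t)%:R <= c * W t.

Lemma powR2_gt4 : 4 < B.
Proof.
have -> : 4 = 2 `^ 2%:R :> R by rewrite powR_mulrn // -natrX.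
by rewrite /powR !gt_eqF ?ltr0n // ltr_expR ltr_pM2r ?ln_gt0 ?ltr1n.
Qed.

Lemma sqr_le_powR n : (0 < n)%N -> (n * n)%N%:R <= n%:R `^ omega.
Proof.
move=> n_gt0; rewrite natrM -expr2 -powR_mulrn ?ler0n //.
by rewrite ler_powR ?ler1n // ltW.
Qed.

Lemma powR_double t : W t.+1 = B * W t.
Proof. by rewrite expnS natrM powRM // ?ler0n. Qed.

(** The fraction is the fixed point of K B = 4 K + 3 (5 c + 3) B, which is where B > 4 enters; the
    summand 4 covers the 1 x 1 base case. *)
Definition ginv_constant : R := 4 + 3 * (5 * c + 3) * B / (B - 4).

Lemma ginv_cost_le t : (ginv_cost cmul t)%:R <= ginv_constant * W t.
Proof.
have B4 := powR2_gt4.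
set K := ginv_constant; have K_step : K * B = 4 * K + (B - 4) * 4 + 3 * (5 * c + 3) * B.
  by rewrite /K /ginv_constant; field; lra.
have K_ge4 : 4 <= K.
  have Bm4 : 0 <= B - 4 by rewrite subr_ge0 ltW.
  rewrite /K /ginv_constant lerDl divr_ge0 //.
  by rewrite !(mulr_ge0, addr_ge0) ?powR_ge0.
elim: t => [|t IH]; first by rewrite expn0 powR1 mulr1.
have W_ge0 : 0 <= W t by apply: powR_ge0.
rewrite [ginv_cost _ _]/= natrD !natrM natrD !natrM -natrM powR_double.
have := cmul_le t.+1; have := @sqr_le_powR (2 ^ t.+1) _; rewrite expn_gt0 => /(_ isT).
rewrite powR_double => sq cm.
have : K * (B * W t) = 4 * (K * W t) + (B - 4) * 4 * W t + 3 * (5 * (c * (B * W t)) + 3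
  * (B * W t)).
  by rewrite mulrA K_step; ring.
have : 0 <= (B - 4) * 4 * W t by rewrite !mulr_ge0 // subr_ge0 ltW.
by move: IH sq cm; move: (K * W t) (B * W t) => ? ?; lra.
Qed.

End MatrixCost.

(** L is the number of binary digits of q; the factor 2 absorbs the rounding, since q >= 2. *)
Lemma log_exponent (R : realType) q : (1 < q)%N ->
  exists2 L, (q < 2 ^ L)%N & L%:R <= 2 / ln 2 * ln q%:R :> R.
Proof.
move=> q_gt1; exists (trunc_log 2 q).+1; first exact: trunc_log_ltn.
have ln2_gt0 : 0 < ln 2 :> R by rewrite ln_gt0 // ltr1n.
set t := trunc_log 2 q; have t_gt0 : (0 < t)%N by rewrite trunc_log_gt0.
have : t%:R * ln 2 <= ln q%:R :> R.
  rewrite mulr_natl -lnXn // ler_ln ?posrE ?exprn_gt0 ?ltr0n // ?(ltnW q_gt1) //.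
  by rewrite -natrX ler_nat trunc_logP // ltnW.
move=> le_t; rewrite mulrAC ler_pdivlMr //.
have : t.+1%:R * ln 2 <= (2 * t)%N%:R * ln 2 :> R.
  by rewrite ler_pM2r // ler_nat; lia.
by rewrite natrM -mulrA; lra.
Qed.

(** * The algorithm *)

Lemma avail_addresses (F : fieldType) (I : Type) (m : memory F I) n
    (v : nat -> nat -> I -> F) :
  (forall i j, (j < n)%N -> avail m (v i j)) ->
  exists at_v : nat -> nat -> nat,
    forall i j, (j < n)%N -> forall x, (m x)`_(at_v i j) = v i j x.
Proof.
move=> avv.
have addr i j : exists p, (j < n)%N -> forall x, (m x)`_p = v i j x.
  case: (ltnP j n) => [lt_j|_]; last by exists 0%N.
  by have [p _ pE] := avv i j lt_j; exists p.
have [at_v at_vE] := choice (fun i => let: existT g gE := choice (addr i) in ex_intro _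
  g gE).
by exists at_v.
Qed.

Definition program_cost r s L mu cg cm : nat :=
  ((r.+1 + r * r * 4 + L * (2 * (3 * mu + r)) + r * (3 * mu + r)) +
   (s.+1 * (r * (3 * mu + r) + r * (r * 4))) + (cg + cm + 5 * (r * r)) +
   s * (r * (r * 2) + r * 2))%N.

Section Assembly.

Variables (F : finFieldType) (r s L mu cg cm N : nat).
Variable (P : {poly F} -> {poly F} -> Prop).
Hypotheses (r_gt1 : (1 < r)%N) (s_gt0 : (0 < s)%N).
Hypotheses (mulr : polymul_within F r mu) (lt_q : (#|F| < 2 ^ L)%N).
Hypotheses (rN : (r <= N)%N) (mmN : matmul_within F N cm).
Hypothesis ginv : forall I : Type, ginv_within F I r r cg.
Hypothesis P_spec : forall f h, P f h ->
  [/\ irreducible_poly f, size f = r.+1, h \is monic, size h = s.+1 & h %| 'X^r - 1].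

Local Notation f_normal f := ((lead_coef f)^-1 *: f).

Lemma hat_k_eq0P (I : Type) (f0 h : I -> {poly F}) x (v : 'cV[F]_r) (a : kfield (f0 x)) :
  P (f0 x) (h x) -> (forall j : 'I_r, (a : {poly F})`_j = v j 0) ->
  hat_k (h x) a = 0 <-> hhat_matrix f0 h r s x *m v = 0.
Proof.
move=> /P_spec[f_irr f_size h_monic h_size _] av.
have coefE (i : 'I_r) : (hat_k (h x) a : {poly F})`_i = (hhat_matrix f0 h r s x *m v) i 0.
  rewrite [in LHS](k_sum_Xn f_irr f_size a) hat_k_linear poly_of_qpoly_sum coef_sum mxE.
  apply: eq_bigr => j _; rewrite mxE coefZ mulrC av; congr (_ * _).
  have := hat_k_Xn f_irr f_size (ltn_ord j) (eq_leq h_size).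
  exact: (congr1 (fun p : {poly F} => p`_i)).
split=> [h0|m0]; first by apply/colP => i; rewrite -coefE h0 coef0 mxE.
apply: val_inj; apply/polyP => i /=; rewrite coef0; case: (ltnP i r) => [lt_i|le_i].
  by rewrite (coefE (Ordinal lt_i)) m0 mxE.
by rewrite nth_default // (leq_trans (size_k f_irr f_size _)).
Qed.

Lemma theta_coordE (I : Type) (f0 h : I -> {poly F}) x (a : kfield (f0 x)) n :
  P (f0 x) (h x) ->
  theta_coord f0 h s x a n = hat_k (b_desc (h x) n) a :> {poly F}.
Proof.
move=> /P_spec[f_irr f_size h_monic h_size _].
elim: n => [|n IH]; first by rewrite hat_kC scale1r.
rewrite (b_descS h_size) hat_kD hat_kMX hat_kC.
transitivity (theta_coord f0 h s x a n ^+ #|F| %% f_normal (f0 x)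
  + (h x)`_(s.-1 - n) *: (a : {poly F})); first by [].
by rewrite IH -(val_expk f_irr f_size).
Qed.

Lemma allombert_algorithm : exists A : algorithm F,
  (algorithm_cost A <= program_cost r s L mu cg cm)%N /\
  forall f h, P f h -> exists theta : kzeta f h,
    [/\ allombert_revised A theta, theta != 0 & sigma theta = zeta * theta].
Proof.
have r_gt0 := ltnW r_gt1.
(* All programs are built over the type of all admissible pairs, before any of them is singled
   out. *)
pose I := {fh : {poly F} * {poly F} | P fh.1 fh.2}.
pose f0 (x : I) := (sval x).1; pose h (x : I) := (sval x).2.
have Px x : P (f0 x) (h x) by apply: (svalP x).
have f0_irr x : irreducible_poly (f0 x) by have [] := P_spec (Px x).
have f0_size x : size (f0 x) = r.+1 by have [] := P_spec (Px x).
have h_monic x : h x \is monic by have [] := P_spec (Px x).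
have h_size x : size (h x) = s.+1 by have [] := P_spec (Px x).
have h_dvd x : h x %| 'X^r - 1 by have [] := P_spec (Px x).
have m0_size x : size (f0 x ++ h x) = (r.+1 + s.+1)%N by rewrite size_cat f0_size h_size.
pose m0 := Memory m0_size.
have avf0 j : (j < r.+1)%N -> avail m0 (fun x => (f0 x)`_j).
  move=> lt_j; exists j; first by rewrite /= ltn_addr.
  by move=> x; rewrite /= nth_cat f0_size lt_j.
have avh j : (j < s.+1)%N -> avail m0 (fun x => (h x)`_j).
  move=> lt_j; exists (r.+1 + j)%N; first by rewrite /= ltn_add2l.
  by move=> x; rewrite /= nth_cat f0_size ltnNge leq_addr /= addKn.
have [m1 [[code1 le1 run1] _ rdy1]] := attains_sigma r_gt1 mulr f0_size h_size lt_q
  avf0 avh.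
have [m2 [[code2 le2 run2] s12 avH]] := attains_hhat s r_gt1 mulr f0_size rdy1.
have rdy2 := sigma_ready_sub s12 rdy1; have [[av0 _ _] _ avphi] := rdy1.
have sing x : exists2 v : 'cV_r, v != 0 & hhat_matrix f0 h r s x *m v = 0.
  have sh : (1 < size (h x))%N by rewrite h_size ltnS.
  have [a nza ha] := hat_k_singular (f0_irr x) (f0_size x) sh (h_dvd x).
  pose v : 'cV[F]_r := \col_j (a : {poly F})`_j.
  have av (j : 'I_r) : (a : {poly F})`_j = v j 0 by rewrite mxE.
  exists v; last exact/(hat_k_eq0P (Px x) av).
  apply: contraNneq nza => v0; apply/eqP/val_inj/polyP => j; rewrite coef0.
  case: (ltnP j r) => [lt_j|le_j]; first by rewrite (av (Ordinal lt_j)) v0 mxE.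
  by rewrite nth_default // (leq_trans (size_k (f0_irr x) (f0_size x) a)).
have [m3 [[code3 le3 run3] s23 [v avv vP]]] :=
  attains_kernel_poly r_gt1 rN mmN (@ginv I) avH (s12 _ av0) sing.
have rdy3 := sigma_ready_sub s23 rdy2.
have size_v x : (size (poly_of_col (v x)) <= r)%N by apply: size_poly.
have [m4 [[code4 le4 run4] _ avT]] := attains_theta s f0_size rdy3 avv size_v.
have [at1 at1E] := avail_addresses (n := r)
  (v := fun i j x => (conj_power f0 1 j x)`_i) (fun i j lt_j => avphi j lt_j i).
have [at2 at2E] := avail_addresses (n := r)
  (v := fun i j x => (hhat_column f0 h s j x)`_i) (fun i j lt_j => avH j lt_j i).
(* The kernel vector has a single index; the first one is a dummy, later set to 0. *)
have [at3 at3E] := avail_addresses (m := m3) (n := r)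
  (v := fun _ j x => (poly_of_col (v x))`_j) (fun _ j _ => avv j).
have [at4 at4E] := avail_addresses (m := m4) (n := r)
  (v := fun i j x => (theta_coord f0 h s x (poly_of_col (v x)) (s.-1 - i))`_j)
  (fun i j _ => avT (s.-1 - i)%N (leq_trans (leq_subr _ _) (leq_pred _)) j).
exists (Algorithm code1 at1 code2 at2 code3 (at3 0%N) code4 at4); split.
  by rewrite /algorithm_cost /program_cost !leq_add.
move=> f1 h1 Pfh; pose x : I := exist _ (f1, h1) Pfh.
pose a : kfield f1 := in_qpoly (f_normal f1) (poly_of_col (v x)).
have aE : a = poly_of_col (v x) :> {poly F}.
  exact: val_in_k_small (f0_irr x) (f0_size x) _ (size_v x).
have av (j : 'I_r) : (a : {poly F})`_j = v x j 0.
  by rewrite aE coef_rVpoly insubT //= => lt_j; rewrite mxE; congr (v x _ _); apply: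
    val_inj.
have [nzv Hv] := vP x.
have ha : hat_k h1 a = 0 by apply/(hat_k_eq0P (Px x) av).
have nza : a != 0.
  apply: contraNneq nzv => a0; apply/eqP/colP => j.
  by rewrite -av a0 coef0 mxE.
exists (in_qpoly _ (theta_poly h1 s a) : kzeta f1 h1); split.
- have lt_r (j : 'I_((size f1).-1)) : (j < r)%N.
    by rewrite (leq_trans (ltn_ord j)) // [size f1](f0_size x).
  exists (m1 x), (m2 x), (m3 x), (m4 x), a; split.
  + split; first exact: (run1 x).
    apply/matrixP => i j; rewrite !mxE at1E //.
    by rewrite -[frob _]/(iter 1 (@frob F f1) _) (iter_frob_Xn (f0_irr x) (f0_size x)).
  + split; first exact: (run2 x).
    apply/matrixP => i j; rewrite !mxE at2E //.
    by rewrite (hat_k_Xn (f0_irr x) (f0_size x) (lt_r j) (eq_leq (h_size x))).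
  + split; first exact: (run3 x).
    split=> // j; rewrite [size f1](f0_size x) => lt_j.
    by rewrite at3E // aE.
  + split; first exact: (run4 x).
    move=> i j; rewrite [size f1](f0_size x) [size h1](h_size x) => lt_i lt_j.
    rewrite at4E // (val_theta (h_monic x) s_gt0 (h_size x)).
    rewrite coef_theta_poly ifT // -aE.
    by rewrite (theta_coordE (x := x) _ _ (Px x)).
  + by rewrite (hat_bpoly (h_monic x) s_gt0 (h_size x)).
- exact: (theta_neq0 (h_monic x) s_gt0 (h_size x) nza).
- exact: (sigma_theta (f0_irr x) (f0_size x) (h_monic x) s_gt0 (h_size x) ha).
Qed.

End Assembly.

(** A modular product costs at most 4 M(r). The exponentiation gives 8 c1 M(r) log q, and the other
    terms are multiples of z = s r M(r): 10 from the first step, 16 from the second, 5 from the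
    third and 4 from the last, 35 in all. *)
Lemma program_cost_le (R : realType) r s L mu cg cm (Mr lq W c1 c3 : R) :
  (0 < r)%N -> (0 < s)%N -> mu%:R <= Mr -> r%:R <= Mr -> L%:R <= c1 * lq ->
  0 <= c1 -> 0 <= lq -> 0 <= c3 -> (cg + cm)%:R <= c3 * W -> 0 <= W ->
  (program_cost r s L mu cg cm)%:R <=
    (8 * c1 + 35 + c3) * (Mr * lq + s%:R * r%:R * Mr + W).
Proof.
move=> r_gt0 s_gt0 le_mu le_r le_L c1_ge0 lq_ge0 c3_ge0 le_cg W_ge0.
set x : R := r%:R; set y : R := s%:R; set z := y * x * Mr.
have x_ge1 : 1 <= x by rewrite ler1n.
have y_ge1 : 1 <= y by rewrite ler1n.
have xM : x <= Mr := le_r.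
have xx_z : x * x <= z.
  by rewrite /z -mulrA -[x * x]mul1r ler_pM // ?ler_wpM2l //; nra.
have yxx_z : y * (x * x) <= z by rewrite /z -mulrA; do 2 (apply: ler_wpM2l; first lra).
have xM_z : x * Mr <= z by rewrite /z -mulrA ler_peMl //; nra.
have x_z : x <= z by apply: le_trans xx_z; nra.
have z_ge0 : 0 <= z by lra.
set m : R := 3 * mu%:R + x.
have m_le : m <= 4 * Mr by rewrite /m; lra.
have m_ge0 : 0 <= m by rewrite /m addr_ge0 ?mulr_ge0 ?ler0n //; lra.
have xm_z : x * m <= 4 * z.
  by apply: le_trans (ler_wpM2l _ m_le) _; lra.
have yxm_z : y * (x * m) <= 4 * z.
  have -> : 4 * z = y * (x * (4 * Mr)) by rewrite /z; ring.
  by do 2 (apply: ler_wpM2l; first lra).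
have yx_z : y * x <= z by apply: le_trans yxx_z; rewrite ler_wpM2l //; nra.
have Lm : L%:R * m <= 4 * c1 * (Mr * lq).
  have -> : 4 * c1 * (Mr * lq) = c1 * lq * (4 * Mr) by ring.
  by apply: ler_pM; rewrite ?ler0n.
have T1_ge0 : 0 <= Mr * lq by rewrite mulr_ge0 //; lra.
rewrite /program_cost !(natrD, natrM) -[r.+1%:R]natr1 -[s.+1%:R]natr1 -/x -/y -/z.
rewrite -/m.
move: le_cg; rewrite natrD => le_cg.
have b1 : 0 <= (35 + c3) * (Mr * lq) by apply: mulr_ge0 => //; lra.
have b2 : 0 <= (8 * c1 + c3) * z by apply: mulr_ge0 => //; lra.
have b3 : 0 <= (8 * c1 + 35) * W by apply: mulr_ge0 => //; lra.
have -> : (8 * c1 + 35 + c3) * (Mr * lq + z + W) =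
  8 * c1 * (Mr * lq) + 35 * z + c3 * W + (35 + c3) * (Mr * lq) + (8 * c1 + c3) * z
  + (8 * c1 + 35) * W by ring.
lra.
Qed.

Theorem proposition6 (R : realType) (M : finFieldType -> nat -> R) (omega : R)
    (M_mul : forall F : finFieldType, polymul_cost F (M F))
    (M_super : forall F : finFieldType, superlinear (M F))
    (M_almost : forall F : finFieldType, almost_linear (M F))
    (omega_gt2 : 2 < omega) (omega_mul : matmul_exponent omega) :
  exists C : R,
  forall (F : finFieldType) (p : nat) (r l e : nat) (u : {unit 'Z_r}),
    p \in [pchar F] ->
    prime l -> (0 < e)%N -> r = (l ^ e)%N -> ~~ (p %| r)%N ->
    FinRing.uval u = #|F|%:R ->
    let s := #[u]%g in
    exists A : algorithm F,
      (algorithm_cost A)%:R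
        <= C * (M F r * ln #|F|%:R + s%:R * r%:R * M F r + r%:R `^ omega) /\
      forall f h : {poly F},
        irreducible_poly f -> size f = r.+1 ->
        irreducible_poly h -> h \is monic -> h %| map_poly intr 'Phi_r ->
        exists theta : kzeta f h,
          [/\ allombert_revised A theta, theta != 0 & sigma theta = zeta * theta].
Proof.
have [c matmul] := omega_mul.
have c_ge0 : 0 <= c.
  (* The sign of c is read off a 1 x 1 product: its cost is nonnegative and at most c. *)
  have [code [out [_ cost_le _]]] := matmul 'F_2 1%N isT.
  by move: cost_le; rewrite powR1 mulr1; apply: le_trans; rewrite ler0n.
pose K := ginv_constant omega c.
have K_ge0 : 0 <= K.
  have B4 := powR2_gt4 omega_gt2; have Bm4 : 0 <= 2 `^ omega - 4 by lra.
  rewrite /K /ginv_constant addr_ge0 // divr_ge0 //.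
  by rewrite !(mulr_ge0, addr_ge0) ?powR_ge0.
(* The factor 2^omega pays for rounding r up to a power of two, which is at most 2r. *)
pose c3 := (K + c) * 2 `^ omega.
have c3_ge0 : 0 <= c3 by rewrite /c3 mulr_ge0 ?powR_ge0 // addr_ge0.
have ln2_gt0 : 0 < ln 2 :> R by rewrite ln_gt0 // ltr1n.
pose c1 : R := 2 / ln 2.
have c1_ge0 : 0 <= c1 by rewrite divr_ge0 // ltW.
(* The constant depends only on omega and c, and is fixed before the field and the degree. *)
exists (8 * c1 + 35 + c3) => F p r l e u pcharFp l_pr e_gt0 rE p_ndvd uq s.
case: e e_gt0 rE => // e _ rE.
have r_gt1 : (1 < r)%N.
  by rewrite rE (leq_trans (prime_gt1 l_pr)) // expnS leq_pmulr // expn_gt0 prime_gt0.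
have r_gt0 := ltnW r_gt1.
have s_gt0 : (0 < s)%N by rewrite order_gt0.
have mm t : exists cm, matmul_within F (double_iter t) cm /\
    cm%:R <= c * (2 ^ t)%N%:R `^ omega.
  rewrite -double_iterE.
  have [|code [out [_ cost_le run_code]]] := matmul F (double_iter t).
    by rewrite double_iterE expn_gt0.
  by exists (cost code); split=> //; exists code, out.
have [cmul cmulP] := choice mm.
pose t := up_log 2 r.
have rN : (r <= double_iter t)%N by rewrite double_iterE up_logP.
have N2r : (2 ^ t <= 2 * r)%N.
  have := up_log_gtn (isT : (1 < 2)%N) r_gt1; rewrite -/t.
  by have: (0 < t)%N by [rewrite up_log_gt0]; case: (t) => // t' _ /= /ltnW; rewrite
    expnS leq_mul2l.
have ginv (I : Type) : ginv_within F I r r (ginv_cost cmul t).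
  by apply: ginv_shrink rN _; apply: ginv_square => v; have [] := cmulP v.
have W_le : (2 ^ t)%N%:R `^ omega <= 2 `^ omega * r%:R `^ omega.
  rewrite -powRM ?ler0n // -natrM ge0_ler_powR ?nnegrE ?ler0n ?ler_nat //; lra.
have cost3 : (ginv_cost cmul t + cmul t)%N%:R <= c3 * r%:R `^ omega.
  have cmul_le v := proj2 (cmulP v).
  have := ginv_cost_le omega_gt2 c_ge0 cmul_le t; have := cmul_le t; rewrite -/K natrD.
  have := ler_wpM2l K_ge0 W_le; have := ler_wpM2l c_ge0 W_le.
  by rewrite /c3 mulrDl mulrDl -!mulrA; lra.
have [code [out [cost_mul run_mul]]] := M_mul F r r_gt0.
have mulr : polymul_within F r (cost code) by exists code, out.
have [L lt_q L_le] := log_exponent R (finNzRing_gt1 F).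
pose P (f h : {poly F}) := [/\ irreducible_poly f, size f = r.+1, irreducible_poly h,
  h \is monic & h %| map_poly intr 'Phi_r].
have P_spec f h : P f h ->
    [/\ irreducible_poly f, size f = r.+1, h \is monic, size h = s.+1 & h %| 'X^r - 1].
  case=> f_irr f_size h_irr h_monic h_Phi; split=> //.
    clear -pcharFp l_pr p_ndvd h_irr h_Phi uq rE.
    by subst r; apply: size_cyclotomic_factor pcharFp l_pr p_ndvd h_irr h_Phi _ uq.
  by rewrite rE (factor_dvd_Xn_sub1 l_pr) // -rE.
have mmN := proj1 (cmulP t).
have [A [cost_A A_correct]] :=
  allombert_algorithm r_gt1 s_gt0 mulr lt_q rN mmN ginv P_spec.
exists A; split; last by move=> f h *; apply: A_correct.
apply: le_trans (program_cost_le r_gt0 s_gt0 cost_mul _ L_le c1_ge0 _ c3_ge0 cost3 _).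
- by rewrite ler_nat.
- exact: polymul_cost_ge.
- by rewrite ln_ge0 // ler1n ltnW // finNzRing_gt1.
- exact: powR_ge0.
Qed.
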